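(* A permutation group $G$ is contained in $\mathcal{H}$ if and only if there exists a finite sequence of permutation groups $G_0,G_1,\dots,G_m$ with $G_m=G$ such that (1) $G_0=\operatorname{id}(\{\emptyset\})$, the trivial group on a one-element set, and (2) for all $1\leq i\leq m$ one of the following holds: (a) $G_i$ is isomorphic as a permutation group to $G_j$ for some $j<i$; (b) $G_i$ is a finite direct product of some of the groups $G_j$ with $j<i$; (c) $G_i=G_j\wr \operatorname{Sym}(\omega)$ for some $j<i$; (d) $G_i$ is a finite index supergroup of some $G_j$ with $j<i$.
   Context: A permutation group is a subgroup $G$ of $\operatorname{Sym}(X)$ for some set $X=\operatorname{Dom}(G)$; it is closed if it is closed in $\operatorname{Sym}(X)$ in the topology of pointwise convergence. Two permutation groups $G,H$ are isomorphic as permutation groups if there is a bijection $e\colon\operatorname{Dom}(G)\to\operatorname{Dom}(H)$ with $eGe^{-1}=H$. A finite index supergroup of $G\le \operatorname{Sym}(X)$ is a group $G'$ with $G\le G'\le\operatorname{Sym}(X)$ and $|G':G|<\infty$. For a finite family of permutation groups $G_i$ with pairwise disjoint domains $X_i$, the direct product $\prod_iG_i$ is the group of all permutations of $\bigcup_iX_i$ that fix each $X_i$ setwise and act on it as an element of $G_i$ (the empty product is the trivial group on the empty set). For $G\le\operatorname{Sym}(X)$, the wreath product $G\wr\operatorname{Sym}(\omega)$ is the group of all permutations of $X\times\omega$ of the form $(x,y)\mapsto(\alpha_y(x),\beta(y))$ with $\beta\in\operatorname{Sym}(\omega)$ and $\alpha_y\in G$ for all $y\in\omega$. For $Y\subset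 X$, $G_{((Y))}$ denotes the restriction to $Y$ of the subgroup of $G$ fixing every element of $X\setminus Y$. A congruence of $G$ is a $G$-invariant equivalence relation $E$ on $X$, and $G/E$ is the permutation group induced by $G$ on the $E$-classes. An $\omega$-partition of $G\le\operatorname{Sym}(X)$ is a triple $(K,\nabla,\Delta)$ such that: (1) $K\subset X$ is finite and fixed setwise by $G$; (2) $\Delta\subset\nabla$ are congruences of $G|_{X\setminus K}$; (3) $\nabla$ has finitely many classes; (4) every $\nabla$-class is a union of $\aleph_0$ many $\Delta$-classes; (5) $G_{((C))}/\Delta=\operatorname{Sym}(C/\Delta)$ for every $\nabla$-class $C$. (If $X=K$ then $\nabla=\Delta=\emptyset$ and (2)-(5) hold trivially.) Its components are the groups $G_{((Y))}$ for $\Delta$-classes $Y$. Put $\mathcal{H}_{-1}=\emptyset$; for $n\ge0$, a closed permutation group $G$ is in $\mathcal{H}_n$ iff $G$ has an $\omega$-partition all of whose components are in $\mathcal{H}_{n-1}$; and $\mathcal{H}=\bigcup_{n\in\omega}\mathcal{H}_n$. *)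

(* Defs.v *)
From HB Require Import structures.
From mathcomp Require Import all_boot.
From mathcomp Require Import all_classical.
From mathcomp Require Import topology function_spaces.

Set Implicit Arguments.
Unset Strict Implicit.
Unset Printing Implicit Defensive.

Local Open Scope classical_set_scope.
Local Open Scope card_scope.

Definition Sym (X : Type) : set (X -> X) := [set f | bijective f].

(* A subgroup of Sym(X), as a set of functions. *)
Record permGroup (X : Type) := PermGroup {
  perms : set (X -> X);
  perms_sub : perms `<=` @Sym X;
  perms_id : perms id;
  perms_comp : forall f g, perms f -> perms g -> perms (f \o g);
  perms_inv : forall f g, perms f -> cancel f g -> cancel g f -> perms g
}.

(* A permutation group together with its domain. *)
Record dPermGroup := DPermGroup {
  Dom : Type;
  grp :> permGroup Dom
}.

(* X carries the discrete topology and X -> X the topology of pointwise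
   convergence; closedness is relative to the subspace Sym(X). *)
Definition closed_group (X : Type) (G : permGroup X) : Prop :=
  closed (perms G :
    set (subspace (@Sym X : set {ptws X -> discrete_topology {classic X}}))).

Program Definition trivialGroup (X : Type) : permGroup X :=
  @PermGroup X [set id] _ _ _ _.
Next Obligation. by move=> X _ ->; exists id. Qed.
Next Obligation. by []. Qed.
Next Obligation. by move=> X f g -> ->. Qed.
Next Obligation. by move=> X f g -> fg _; apply/funext => x; exact: fg. Qed.

Definition isomorphic (G H : dPermGroup) : Prop :=
  exists (e : Dom G -> Dom H) (e' : Dom H -> Dom G),
    [/\ cancel e e', cancel e' e &
        [set e \o g \o e' | g in perms G] = perms H].

(* Finitely many left cosets gG with g in G'. *)
Definition finite_index_supergroup (X : Type) (G G' : permGroup X) : Prop :=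
  perms G `<=` perms G' /\
  finite_set [set [set g \o h | h in perms G] | g in perms G'].

(* The disjoint union of the domains is the sigma type {i : I & X i}. *)
Program Definition directProduct (I : Type) (X : I -> Type)
    (G : forall i, permGroup (X i)) : permGroup {i : I & X i} :=
  @PermGroup _ [set f | bijective f /\ forall i, exists2 g, perms (G i) g &
                  forall x, f (existT X i x) = existT X i (g x)] _ _ _ _.
Next Obligation. by move=> I X G f []. Qed.
Next Obligation.
move=> I X G; split; first by exists id.
by move=> i; exists id => //; exact: perms_id.
Qed.
Next Obligation.
move=> I X G f g [fb fG] [gb gG]; split; first exact: bij_comp.
move=> i; have [f' Gf' ff'] := fG i; have [g' Gg' gg'] := gG i.
exists (f' \o g'); first exact: perms_comp.
by move=> x /=; rewrite gg' ff'.
Qed.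
Next Obligation.
move=> I X G f g [fb fG] fg gf; split; first by exists f.
move=> i; have [f' Gf' ff'] := fG i.
have [g' fg' gf'] := perms_sub Gf'.
exists g'; first exact: perms_inv Gf' fg' gf'.
by move=> x; rewrite -{1}(gf' x) -ff' fg.
Qed.

(* G wr Sym(omega), with omega = nat. *)
Program Definition wreath (X : Type) (G : permGroup X) : permGroup (X * nat) :=
  @PermGroup _ [set f | exists (alpha : nat -> X -> X) (beta : nat -> nat),
                  [/\ Sym beta, forall y, perms G (alpha y) &
                      forall x y, f (x, y) = (alpha y x, beta y)]] _ _ _ _.
Next Obligation.
move=> X G f [a [b [[b' bb' b'b] Ga fE]]].
have /choice [a' a'P] : forall y, exists h, cancel (a y) h /\ cancel h (a y).
  by move=> y; have [h ? ?] := perms_sub (Ga y); exists h.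
exists (fun p => (a' (b' p.2) p.1, b' p.2)) => -[x y] /=.
  by rewrite fE /= bb' (a'P y).1.
by rewrite fE b'b (a'P (b' y)).2.
Qed.
Next Obligation.
move=> X G; exists (fun=> id), id; split => //; first by exists id.
by move=> _; exact: perms_id.
Qed.
Next Obligation.
move=> X G f g [a [b [bb Ga fE]]] [c [d [bd Gc gE]]].
exists (fun y => a (d y) \o c y), (b \o d); split.
- exact: bij_comp.
- by move=> y; exact: perms_comp.
- by move=> x y /=; rewrite gE fE.
Qed.
Next Obligation.
move=> X G f g [a [b [[b' bb' b'b] Ga fE]]] fg gf.
have /choice [a' a'P] : forall y, exists h, cancel (a y) h /\ cancel h (a y).
  by move=> y; have [h ? ?] := perms_sub (Ga y); exists h.
exists (fun y => a' (b' y)), b'; split.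
- by exists b.
- by move=> y; apply: perms_inv (Ga (b' y)) (a'P _).1 (a'P _).2.
- move=> x y; have := fE (a' (b' y) x) (b' y).
  by rewrite (a'P (b' y)).2 b'b => <-; rewrite fg.
Qed.

(* G|_Y, for Y fixed setwise by G; in general only the permutations of Y that
   are induced by elements of G are kept. *)
Program Definition restriction (X : Type) (G : permGroup X) (Y : set X) :
    permGroup Y :=
  @PermGroup _ [set f | bijective f /\ exists2 g, perms G g &
                  forall y : Y, val (f y) = g (val y)] _ _ _ _.
Next Obligation. by move=> X G Y f []. Qed.
Next Obligation.
by move=> X G Y; split; [exists id | exists id => //; exact: perms_id].
Qed.
Next Obligation.
move=> X G Y f g [fb [f' Gf' ff']] [gb [g' Gg' gg']]; split.
  exact: bij_comp.
exists (f' \o g'); first exact: perms_comp.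
by move=> y /=; rewrite ff' gg'.
Qed.
Next Obligation.
move=> X G Y f g [fb [f' Gf' ff']] fg gf; split; first by exists f.
have [g' fg' gf'] := perms_sub Gf'.
exists g'; first exact: perms_inv Gf' fg' gf'.
by move=> y; rewrite -{2}(gf y) ff' fg'.
Qed.

(* The subgroup of G fixing every element of X \ Y. *)
Program Definition fixOutside (X : Type) (G : permGroup X) (Y : set X) :
    permGroup X :=
  @PermGroup _ [set g | perms G g /\ forall x, ~ Y x -> g x = x] _ _ _ _.
Next Obligation. by move=> X G Y f [/perms_sub]. Qed.
Next Obligation. by move=> X G Y; split => //; exact: perms_id. Qed.
Next Obligation.
move=> X G Y f g [Gf fY] [Gg gY]; split; first exact: perms_comp.
by move=> x Yx /=; rewrite gY// fY.
Qed.
Next Obligation.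
move=> X G Y f g [Gf fY] fg gf; split; first exact: perms_inv Gf fg gf.
by move=> x Yx; rewrite -{1}(fY x Yx) fg.
Qed.

(* G_((Y)) *)
Definition localGroup (X : Type) (G : permGroup X) (Y : set X) : permGroup Y :=
  restriction (fixOutside G Y) Y.

(* An equivalence relation on a subset A of X is represented by the set of its
   pairs, hence by a relation E on X with E x x exactly for x in A. *)
Definition classes (X : Type) (E : X -> X -> Prop) : set (set X) :=
  [set E x | x in [set x | E x x]].

Definition relRestriction (X : Type) (E : X -> X -> Prop) (Y : set X) :
    Y -> Y -> Prop :=
  fun y z => E (val y) (val z).

Definition congruence (X : Type) (G : permGroup X) (E : X -> X -> Prop) :
    Prop :=
  [/\ forall x, E x x,
      forall x y, E x y -> E y x,
      forall x y z, E x y -> E y z -> E x z &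
      forall g, perms G g -> forall x y, E x y -> E (g x) (g y)].

(* G/E, acting on the type of E-classes. *)
Program Definition quotientGroup (X : Type) (G : permGroup X)
    (E : X -> X -> Prop) : permGroup (classes E) :=
  @PermGroup _ [set f | bijective f /\ exists2 g, perms G g &
                  forall C : classes E, val (f C) = g @` val C] _ _ _ _.
Next Obligation. by move=> X G E f []. Qed.
Next Obligation.
move=> X G E; split; first by exists id.
by exists id; [exact: perms_id | move=> C; rewrite image_id].
Qed.
Next Obligation.
move=> X G E f g [fb [f' Gf' ff']] [gb [g' Gg' gg']]; split.
  exact: bij_comp.
exists (f' \o g'); first exact: perms_comp.
by move=> C /=; rewrite ff' gg' image_comp.
Qed.
Next Obligation.
move=> X G E f g [fb [f' Gf' ff']] fg gf; split; first by exists f.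
have [g' fg' gf'] := perms_sub Gf'.
exists g'; first exact: perms_inv Gf' fg' gf'.
move=> C; rewrite -{2}(gf C) ff' image_comp.
by rewrite (_ : g' \o f' = id) ?image_id//; apply/funext => x; exact: fg'.
Qed.

(* nabla and delta are equivalence relations on X \ K (as sets of pairs). *)
Record omega_partition (X : Type) (G : permGroup X) (K : set X)
    (nabla delta : X -> X -> Prop) : Prop := OmegaPartition {
  op_finite : finite_set K;
  op_fixed : forall g, perms G g -> g @` K = K;
  op_supp : forall x y, nabla x y -> ~ K x /\ ~ K y;
  op_sub : forall x y, delta x y -> nabla x y;
  op_nabla : congruence (restriction G (~` K)) (@relRestriction X nabla (~` K));
  op_delta : congruence (restriction G (~` K)) (@relRestriction X delta (~` K));
  op_nabla_finite : finite_set (classes nabla);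
  op_nabla_class : forall C, classes nabla C ->
    exists S : set (set X), [/\ S `<=` classes delta, S #= [set: nat] &
                                C = \bigcup_(Y in S) Y];
  op_sym : forall C, classes nabla C ->
    perms (quotientGroup (localGroup G C) (@relRestriction X delta C)) =
    @Sym (classes (@relRestriction X delta C))
}.

(* [Hpred n] is H_(n-1), so that [Hpred 0] is H_(-1), the empty class. *)
Fixpoint Hpred (n : nat) (X : Type) (G : permGroup X) : Prop :=
  if n is m.+1 then
    closed_group G /\
    exists (K : set X) (nabla delta : X -> X -> Prop),
      omega_partition G K nabla delta /\
      forall Y, classes delta Y -> Hpred m (localGroup G Y)
  else False.

Definition Hn (n : nat) (X : Type) (G : permGroup X) : Prop := Hpred n.+1 G.

Definition inH (G : dPermGroup) : Prop := exists n, Hn n (grp G).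

(* Main.v *)
Require Import Defs.
From mathcomp Require Import all_boot.
From mathcomp Require Import all_classical.
From mathcomp Require Import topology function_spaces.

Set Implicit Arguments.
Unset Strict Implicit.
Unset Printing Implicit Defensive.

Local Open Scope classical_set_scope.

(** The theorem rests on a description of the groups in the class H by finite
    index.  Call block group a group of the form
    id(K) x M_1 wr Sym(omega) x ... x M_r wr Sym(omega) with K finite.  Then,
    up to isomorphism, the groups in H_(n+1) are exactly those that contain with
    finite index a block group all of whose M_i are in H_n
    ([structure_theorem], [supergroup_HpredS]).  This gives the theorem: from
    left to right, a group in H_(n+1) is a finite index supergroup of a product
    of trivial groups and wreath products of groups M_i in H_n, which are
    derivable by induction; from right to left, the class H has to be closed
    under the four operations, and the only closure that is not immediate,
    under finite index supergroups, holds because containing a given block group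
    with finite index passes to such supergroups.

    That a finite index supergroup G of a block group W has an omega-partition
    means that G respects the points, the fibres and the factors of W.  This is
    a pigeonhole argument.  For g in G and a sequence w_k in W, two of the
    conjugates of the w_k by g lie in one coset of W, so that the conjugate of
    w_k^-1 w_l by g is in W for some k <> l.  Applied to the swaps of a fixed
    fibre with the k-th one, and to the copies in the k-th fibre of a fixed
    element of M_i, this forces g to map fibres to fibres
    ([commensurates_addr]), and likewise factors to factors.

    The converse builds W inside a closed group G with an omega-partition.  An
    element of G that preserves a Delta-class Y normalises the component of Y,
    and a group in H has finite index in its normaliser
    ([normaliser_fin_index]).  Since G is closed, this finiteness yields a
    finite set F of Delta-classes, not containing Y, such that an element of G
    that acts on the classes of F as elements of their components, and that
    preserves Y, acts on Y as an element of its component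
    ([determining_set]).  The pigeonhole principle moves any class to any other
    one of the same Nabla-class by an element that acts on F through components
    ([single_move]), and by the choice of F the bijection obtained between the
    two classes is unique up to the component ([link_uniq]).  These links
    compose, so they identify the Delta-classes of each Nabla-class coherently
    with one of them; because G is closed it contains all permutations that are
    a link on each class, and these form the block group.  Its index is finite
    because, once all classes are preserved, an element is known up to
    components from its action on finitely many determining classes.

    The finiteness of normalisers runs in the same induction.  An element that
    normalises a finite index supergroup of W satisfies the same pigeonhole
    principle, so it respects the fibres; up to finitely many cosets and up to
    W it preserves all of them and acts on the k-th fibre of the i-th factor by
    some u_k in the normaliser of M_i.  Commutators with swaps put
    u_l u_k^-1 in M_i, so only the coset of u_0 matters, for each of the finitely
    many i. *)

(** * Inverses of permutations *)

(** The inverse of a bijection as a total function on any type; the value at a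
    point outside the range is arbitrary. *)
Definition invf (X : Type) (f : X -> X) (y : X) : X :=
  if pselect (exists x, f x = y) is left h then projT1 (cid h) else y.

Lemma invfKd X (f : X -> X) : bijective f -> cancel (invf f) f.
Proof.
move=> [f' fK f'K] y; rewrite /invf; case: pselect => [h|[]]; last by exists (f' y).
by case: (cid h).
Qed.

Lemma invfK X (f : X -> X) : bijective f -> cancel f (invf f).
Proof. by move=> fb x; apply: (bij_inj fb); rewrite invfKd. Qed.

Lemma invf_bij X (f : X -> X) : bijective f -> bijective (invf f).
Proof. by move=> fb; exists f; [exact: invfKd | exact: invfK]. Qed.

Lemma inj_surj_bij (X Y : Type) (f : X -> Y) :
  injective f -> (forall y, exists x, f x = y) -> bijective f.
Proof.
move=> fi /choice [f' f'P]; exists f' => // x.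
by apply: fi; rewrite f'P.
Qed.

Lemma existT_inj (I : eqType) (T : I -> Type) (i : I) (x y : T i) :
  existT T i x = existT T i y -> x = y.
Proof. exact: (@eq_from_Tagged I T i x y). Qed.

Arguments existT_inj {I T i x y}.

Section perms.
Variables (X : Type) (G : permGroup X).

Lemma perms_bij g : perms G g -> bijective g.
Proof. exact: perms_sub. Qed.

Lemma permK g : perms G g -> cancel g (invf g).
Proof. by move=> /perms_bij; exact: invfK. Qed.

Lemma permKd g : perms G g -> cancel (invf g) g.
Proof. by move=> /perms_bij; exact: invfKd. Qed.

Lemma perm_injective g : perms G g -> injective g.
Proof. by move=> /permK /can_inj. Qed.

Lemma perms_invf g : perms G g -> perms G (invf g).
Proof. by move=> Gg; apply: perms_inv Gg (permK Gg) (permKd Gg). Qed.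

End perms.

Lemma invf_comp X (f g : X -> X) : bijective f -> bijective g ->
  invf (f \o g) = invf g \o invf f.
Proof.
move=> fb gb; apply/funext => x; apply: (bij_inj (bij_comp fb gb)).
by rewrite invfKd/= ?invfKd//; exact: bij_comp.
Qed.

Lemma invfV X (f : X -> X) : bijective f -> invf (invf f) = f.
Proof.
move=> fb; apply/funext => x; apply: (bij_inj (invf_bij fb)).
by rewrite invfKd ?invfK//; exact: invf_bij.
Qed.

Lemma invf_eq X (f g : X -> X) : cancel f g -> cancel g f -> invf f = g.
Proof.
move=> fg gf; apply/funext => x; apply: (can_inj fg); rewrite gf invfKd//.
by exists g.
Qed.

(** * Closed subgroups and subgroups of finite index *)

(** Closedness for the topology of pointwise convergence, see [closed_groupP]. *)
Definition pclosed X (G : permGroup X) : Prop :=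
  forall f, bijective f ->
    (forall A : set X, finite_set A ->
       exists2 g, perms G g & forall x, A x -> f x = g x) -> perms G f.

(** The sets of functions that agree with [f] on a finite set generate the
    neighbourhood filter of [f]. *)
Lemma closed_groupP X (G : permGroup X) : closed_group G <-> pclosed G.
Proof.
rewrite /closed_group.
set Y := discrete_topology {classic X}.
have cvgP (F : set_system {ptws X -> Y}) (f : {ptws X -> Y}) : Filter F -> 
    (F --> f) <-> forall x, F [set g | g x = f x].
  move=> FF; split=> [Ff x|H].
    apply: Ff.
    have := @proj_continuous {classic X} (fun=> Y) x f.
    move=> /(_ [set f x]); apply; exact: (@discrete_set1 Y).
  apply/cvg_sup => x.
  apply/cvg_image.
    by apply/seteqP; split => // y _; exists (fun=> y).
  move=> A.
  move=> /principal_filterP Afx.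
  exists [set g : X -> X | A (g x)].
    by apply: filterS (H x) => g /= ->.
  by apply/seteqP; split=> [_ [g Ag <-]//|y Ay]; exists (fun=> y).
split.
  move/closed_subspaceP => [V cV VG] f fb H.
  suff : (V `&` @Sym X) f.
    by rewrite VG => -[].
  split=> //; apply: cV.
  (* the filter generated by the finite approximations of f *)
  pose F : set_system {ptws X -> Y} := fun B => exists2 A : set X, finite_set A &
    [set g : X -> X | forall x, A x -> g x = f x] `<=` B.
  have FF : Filter F.
    split.
    - by exists set0 => //; exact: finite_set0.
    - move=> B C [A fA AB] [A' fA' AC]; exists (A `|` A').
        by rewrite finite_setU.
      by move=> g /= gA; split; [apply: AB|apply: AC] => x Ax; apply: gA; [left|right].
    - by move=> B C BC [A fA AB]; exists A => // g /AB/BC.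
  have Ff : F --> (f : {ptws X -> Y}).
    apply/cvgP => x; exists [set x]; first exact: finite_set1.
    by move=> g /= ->.
  move=> B /Ff[A fA AB].
  have [g Gg gf] := H A fA.
  exists g; split.
    have : (V `&` @Sym X) g; last by case.
    rewrite VG; split => //; exact: perms_bij Gg.
    by apply: AB => /= x Ax; rewrite gf.
move=> H; apply/closed_subspaceP.
exists (closure (perms G : set {ptws X -> Y})); first exact: closed_closure.
apply/seteqP; split=> f [cf fb]; split => //; last exact: subset_closure.
apply: H => // A fA.
have [|g [Gg gf]] := cf [set g | forall x, A x -> g x = f x].
  have : nbhs (f : {ptws X -> Y}) (\bigcap_(x in A) [set g : X -> X | g x = f x]).
    rewrite -[A](@fset_setK {classic X})//.
    have Fn := @nbhs_filter {ptws X -> Y} f.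
    apply: (@filter_bigI _ {classic X}) => x _.
    by apply: (cvgP _ f Fn).1; exact: cvg_id.
  by apply: (@filterS _ _ (@nbhs_filter {ptws X -> Y} f)) => g.
by exists g => // x Ax; rewrite gf.
Qed.

(** Finitely many left cosets p H with p in P, given by a colouring that
    separates the cosets; colours are what the pigeonhole arguments use. *)
Definition fin_index X (P H : set (X -> X)) : Prop :=
  exists (C : finType) (col : (X -> X) -> C),
    forall p q, P p -> P q -> col p = col q -> H (invf p \o q).

Lemma finite_set_col (T : Type) (A : set T) : finite_set A ->
  exists (n : nat) (c : T -> 'I_n.+1), forall x y, A x -> A y -> c x = c y -> x = y.
Proof.
move=> [n]; rewrite card_eq_le => /andP[/pcard_leP /injfunPex[f fA fi] _].
exists n, (fun x => inord (f x)) => x y Ax Ay /(congr1 val) /=.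
rewrite !inordK; [|exact: leqW (fA y Ay)|exact: leqW (fA x Ax)].
by move=> fxy; apply: fi; rewrite ?inE.
Qed.

Lemma infinite_pigeonhole (C : finType) (c : nat -> C) (B : set nat) : infinite_set B ->
  exists k l, [/\ B k, B l, k <> l & c k = c l].
Proof.
move=> Binf; apply: contrapT => H; apply: Binf.
apply: (@sub_finite_set _ _
  ((fun y => xget 0 [set k | B k /\ c k = y]) @` [set: C])); last first.
  exact/finite_image/finite_finset.
move=> k Bk; exists (c k) => //.
case: xgetP => [l _ [Bl cl]|/(_ k)[]//].
by apply: contrapT => lk; apply: H; exists l, k.
Qed.

Lemma fin_indexP X (G G' : permGroup X) :
  finite_index_supergroup G G' <->
  perms G `<=` perms G' /\ fin_index (perms G') (perms G).
Proof.
split=> -[GG' fi]; split=> //.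
  have [n [c cP]] := finite_set_col fi.
  exists 'I_n.+1, (fun g : X -> X => c [set g \o h | h in perms G]) => p q Gp Gq.
  move=> /cP -/(_ (imageP _ Gp) (imageP _ Gq)) pq.
  have : [set q \o h | h in perms G] q by exists id => //; exact: perms_id.
  rewrite -pq => -[h Gh <-].
  rewrite (_ : _ \o _ = h)//; apply/funext => x /=; exact: permK Gp _.
have [C [col colP]] := fi.
pose rep c : set (X -> X) := [set h : X -> X | exists p, [/\ perms G' p, col p = c &
   [set p \o h | h in perms G] h]].
apply: (@sub_finite_set _ _ (rep @` [set: C])); last exact/finite_image/finite_finset.
move=> _ [p Gp <-]; exists (col p) => //; apply/seteqP; split=> h.
  move=> [q [Gq qp [k Gk <-]]].
  exists (invf p \o q \o k).
    by apply: perms_comp Gk; apply: colP.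
  by apply/funext => x /=; rewrite (permKd Gp).
by move=> [k Gk <-]; exists p; split => //; exists k.
Qed.

(** If every element of a finite union of cosets fails to approximate [f] on some
    finite set, the union of these finite sets shows that the whole group does;
    hence one coset approximates [f] everywhere, and it is closed. *)
Lemma pclosed_fin_index X (G G' : permGroup X) :
  perms G `<=` perms G' -> fin_index (perms G') (perms G) ->
  pclosed G -> pclosed G'.
Proof.
move=> GG' [C [col colP]] cG f fb H.
have [c cP] : exists c, forall A, finite_set A -> exists g,
    [/\ perms G' g, col g = c & forall x, A x -> f x = g x].
  apply: contrapT => /forallNP H1.
  have /choice [A AP] : forall c, exists A, finite_set A /\
      ~ exists g, [/\ perms G' g, col g = c & forall x, A x -> f x = g x].
    by move=> c; have /existsNP[A /not_implyP] := H1 c; exists A.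
  have [|g Gg fg] := H (\bigcup_(c in [set: C]) A c).
    by apply: bigcup_finite => [|c _]; [exact: finite_finset | exact: (AP c).1].
  apply: (AP (col g)).2; exists g; split => // x Ax; apply: fg.
  by exists (col g).
have [p [Gp cp _]] := cP _ (finite_set0 X).
have -> : f = p \o (invf p \o f) by apply/funext => x /=; rewrite (permKd Gp).
apply: perms_comp => //; apply: GG'; apply: cG.
  exact/(bij_comp _ fb)/invf_bij/perms_bij/Gp.
move=> A /cP[g [Gg cg fg]].
exists (invf p \o g); last by move=> x /fg /= ->.
by apply: colP => //; rewrite cp.
Qed.

(** * Isomorphic permutation groups *)

Section transport.
Variables (X Y : Type) (e : X -> Y) (e' : Y -> X).
Hypotheses (eK : cancel e e') (eK' : cancel e' e).
Variable G : permGroup X.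

Program Definition transport : permGroup Y :=
  @PermGroup Y [set f | perms G (e' \o f \o e)] _ _ _ _.
Next Obligation.
move=> f /perms_bij fb.
have -> : f = e \o (e' \o f \o e) \o e'.
  by apply/funext => x /=; rewrite !eK'.
apply: bij_comp; last by exists e.
by apply: bij_comp => //; exists e'.
Qed.
Next Obligation.
rewrite /= (_ : _ \o _ = id); first exact: perms_id.
by apply/funext => x /=; rewrite eK.
Qed.
Next Obligation.
move=> f g /= Gf Gg; have := perms_comp Gf Gg; congr (perms G).
by apply/funext => x /=; rewrite eK'.
Qed.
Next Obligation.
move=> f g /= Gf fg gf; apply: perms_inv Gf _ _ => x /=.
  by rewrite eK' fg eK.
by rewrite eK' gf eK.
Qed.

Lemma transport_iso : isomorphic (DPermGroup G) (DPermGroup transport).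
Proof.
exists e, e'; split => //=; apply/seteqP; split => [_ [g Gg <-]|f Gf] /=.
  by rewrite (_ : _ \o _ = g)//; apply/funext => x /=; rewrite !eK.
by exists (e' \o f \o e) => //; apply/funext => x /=; rewrite !eK'.
Qed.

End transport.

Lemma isomorphicP X Y (G : permGroup X) (H : permGroup Y) :
  isomorphic (DPermGroup G) (DPermGroup H) <->
  exists (e : X -> Y) (e' : Y -> X), [/\ cancel e e', cancel e' e &
    forall f, perms H f <-> perms G (e' \o f \o e)].
Proof.
split=> -[e [e' [eK eK' GH]]]; exists e, e'; split=> //=.
  move=> f; rewrite -GH /=; split => [[g Gg <-]|Gf].
    by rewrite (_ : _ \o _ = g)//; apply/funext => x /=; rewrite !eK.
  by exists (e' \o f \o e) => //; apply/funext => x /=; rewrite !eK'.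
apply/seteqP; split => [_ [g Gg <-]|f /GH Gf] /=.
  apply/GH; rewrite (_ : _ \o _ = g)//; apply/funext => x /=.
  by rewrite !eK.
by exists (e' \o f \o e) => //; apply/funext => x /=; rewrite !eK'.
Qed.

Lemma isomorphic_sym G H : isomorphic G H -> isomorphic H G.
Proof.
case: G => X G; case: H => Y H /isomorphicP[e [e' [eK eK' GH]]].
apply/isomorphicP; exists e', e; split=> // f.
rewrite GH (_ : _ \o _ = f)//; apply/funext => x /=.
by rewrite !eK.
Qed.

Lemma pclosed_iso X Y (G : permGroup X) (H : permGroup Y) :
  isomorphic (DPermGroup G) (DPermGroup H) -> pclosed G -> pclosed H.
Proof.
move=> /isomorphicP[e [e' [eK eK' GH]]] cG f fb fA; apply/GH/cG.
  by apply: bij_comp; [apply: bij_comp fb; exists e | exists e'].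
move=> A finA; have [h Hh fh] := fA (e @` A) (finite_image _ finA).
exists (e' \o h \o e); first exact/GH.
by move=> x Ax /=; rewrite fh//; exists x.
Qed.

(** * Omega-partitions as addresses *)

Definition fiber (X I : Type) (a : X -> option (I * nat)) (z : I * nat) : set X :=
  [set x | a x = Some z].

(** An omega-partition whose Delta-classes have been numbered: [a x = None] for
    [x] in K, and [a x = Some (i, k)] when [x] lies in the k-th Delta-class of
    the i-th Nabla-class.  In this form nothing but the domain itself occurs, no
    subtypes and no types of classes, and the symmetric group on the classes
    becomes the group of bijections of [nat]. *)
Record addressing (X : Type) (G : permGroup X) (I : Type)
    (a : X -> option (I * nat)) : Prop := Addressing {
  ad_fin : finite_set [set x | a x = None];
  ad_surj : forall z, exists x, a x = Some z;
  ad_none : forall g x, perms G g -> a x = None -> a (g x) = None;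
  ad_eq : forall g x y, perms G g -> a x = a y -> a (g x) = a (g y);
  ad_idx : forall g x y, perms G g -> omap fst (a x) = omap fst (a y) ->
    omap fst (a (g x)) = omap fst (a (g y));
  ad_sym : forall i (b : nat -> nat), bijective b -> exists g, [/\ perms G g,
    forall x k, a x = Some (i, k) -> a (g x) = Some (i, b k) &
    forall x, omap fst (a x) <> Some i -> g x = x]
}.

Definition insub_set (X : Type) (Y : set X) (x : X) (Yx : Y x) : Y :=
  SigSub (mem_set Yx).

Lemma supp_stable X (g : X -> X) (Y : set X) : injective g ->
  (forall x, ~ Y x -> g x = x) -> forall x, Y x -> Y (g x).
Proof.
move=> gi gY x Yx; apply: contrapT => Ygx.
by have /gi gx := gY _ Ygx; rewrite gx in Ygx.
Qed.

Lemma restr_ex X (g : X -> X) (Y : set X) : bijective g ->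
  (forall x, Y x -> Y (g x)) -> (forall x, Y x -> Y (invf g x)) ->
  exists f : Y -> Y, bijective f /\ forall y, val (f y) = g (val y).
Proof.
move=> gb gY gY'.
exists (fun y : Y => insub_set ((gY _ (set_valP y)))); split=> //.
exists (fun y : Y => insub_set ((gY' _ (set_valP y)))) => y; apply: val_inj => /=.
  by rewrite invfK.
by rewrite invfKd.
Qed.

Lemma localGroup_ex X (G : permGroup X) (g : X -> X) (Y : set X) : perms G g ->
  (forall x, ~ Y x -> g x = x) ->
  exists2 f, perms (localGroup G Y) f & forall y, val (f y) = g (val y).
Proof.
move=> Gg gY; have [||f [fb fg]] := restr_ex (perms_bij Gg) (Y := Y).
- exact: supp_stable (perm_injective Gg) gY.
- apply: supp_stable (perm_injective (perms_invf Gg)) _ => x Yx.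
  by rewrite -{1}(gY x Yx) (permK Gg).
- by exists f => //; split => //; exists g.
Qed.

Section omega_to_addressing.
Variables (X : Type) (G : permGroup X) (K : set X) (nabla delta : X -> X -> Prop).
Hypothesis op : omega_partition G K nabla delta.

(** The congruences of an omega-partition live on the subtype of the complement of
    K; this restates them on the whole domain. *)
Lemma cong_ambient (E : X -> X -> Prop) :
  (forall x y, E x y -> ~ K x /\ ~ K y) ->
  congruence (restriction G (~` K)) (@relRestriction X E (~` K)) ->
  [/\ forall x, ~ K x -> E x x, forall x y, E x y -> E y x,
   forall x y z, E x y -> E y z -> E x z &
   forall g x y, perms G g -> E x y -> E (g x) (g y)].
Proof.
move=> EK [R S T I].
pose s x (Kx : ~ K x) : (~` K : set X) := @insub_set X (~` K) x Kx.
split.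
- by move=> x Kx; have := R (s x Kx).
- by move=> x y Exy; have [Kx Ky] := EK _ _ Exy; exact: (S (s x Kx) (s y Ky)).
- move=> x y z Exy Eyz; have [Kx Ky] := EK _ _ Exy; have [_ Kz] := EK _ _ Eyz.
  exact: (T (s x Kx) (s y Ky) (s z Kz)).
- move=> g x y Gg Exy; have [Kx Ky] := EK _ _ Exy.
  have gK h : perms G h -> forall x, (~` K) x -> (~` K) (h x).
    move=> Gh z Kz Khz; apply: Kz; move: Khz; rewrite -{1}(op_fixed op Gh).
    by move=> [z' Kz' /(perm_injective Gh) <-].
  have [f [fb fg]] := restr_ex (perms_bij Gg) (gK g Gg) (gK _ (perms_invf Gg)).
  have /I /(_ (s x Kx) (s y Ky) Exy) : perms (restriction G (~` K)) f.
    by split=> //; exists g.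
  by rewrite /relRestriction !fg.
Qed.

Lemma op_delta_supp x y : delta x y -> ~ K x /\ ~ K y.
Proof. by move=> /(op_sub op) /(op_supp op). Qed.

Let nE := cong_ambient (op_supp op) (op_nabla op).
Let dE := cong_ambient op_delta_supp (op_delta op).

Lemma nablaE x y : nabla x y -> nabla x = nabla y.
Proof.
have [_ S T _] := nE.
by move=> xy; apply/predeqP => z; split; [exact: T (S _ _ xy) | exact: T].
Qed.

Lemma deltaE x y : delta x y -> delta x = delta y.
Proof.
have [_ S T _] := dE.
by move=> xy; apply/predeqP => z; split; [exact: T (S _ _ xy) | exact: T].
Qed.

Lemma nabla_class_label C : classes nabla C -> exists v : set X -> nat,
  (forall x y, C x -> C y -> v (delta x) = v (delta y) -> delta x = delta y) /\
  forall k, exists2 x, C x & v (delta x) = k.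
Proof.
have [dR dS _ _] := dE; have [nR _ nT _] := nE.
move=> CC; have [S [Sd /card_set_bijP[v [vS vi vs]] CS]] := op_nabla_class op CC.
have SP x : C x -> S (delta x).
  rewrite CS => -[Y SY Yx]; have [y /= yy Yy] := Sd _ SY.
  have yx : delta y x by rewrite Yy.
  by rewrite -(deltaE yx) Yy.
exists v; split.
  by move=> x y Cx Cy; apply: vi; rewrite inE; exact: SP.
move=> k; have [D SD <-] := vs k I; have [x /= xx Dx] := Sd _ SD.
by exists x; rewrite ?Dx// CS; exists D => //; rewrite -Dx.
Qed.

Lemma omega_addressing : exists (r : nat) (a : X -> option ('I_r * nat)),
  addressing G a /\ forall z, classes delta (fiber a z).
Proof.
have [dR dS dT dG] := dE; have [nR nS nT nG] := nE.
have [r /card_set_bijP[f [fS fi fs]]] := op_nabla_finite op.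
have [v vP] : exists v : set X -> set X -> nat, forall C, classes nabla C ->
  (forall x y, C x -> C y -> v C (delta x) = v C (delta y) -> delta x = delta y) /\
  forall k, exists2 x, C x & v C (delta x) = k.
  have : forall C, exists w : set X -> nat, classes nabla C ->
      (forall x y, C x -> C y -> w (delta x) = w (delta y) -> delta x = delta y) /\
      forall k, exists2 x, C x & w (delta x) = k.
    move=> C; have [/nabla_class_label[w wP]|nC] := pselect (classes nabla C).
      by exists w.
    by exists (fun=> 0).
  by move=> /choice[v vP]; exists v.
have nC x : ~ K x -> classes nabla (nabla x) by move=> Kx; exists x => //=; exact: nR.
pose a x : option ('I_r * nat) := if pselect (K x) then None else
  omap (fun i : 'I_r => (i, v (nabla x) (delta x))) (insub (f (nabla x))).
have aK x : K x -> a x = None by rewrite /a; case: pselect.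
have aP x : ~ K x -> exists2 i : 'I_r, val i = f (nabla x) &
    a x = Some (i, v (nabla x) (delta x)).
  move=> Kx; rewrite /a; case: pselect => [/Kx[]|Kx'] /=.
  case: insubP => [i _ iE|]; first by exists i.
  by have /= -> := fS _ (nC x Kx).
have aN x : a x = None -> K x.
  by move=> ax; apply: contrapT => /aP[i _]; rewrite ax.
have an x y : ~ K x -> omap fst (a x) = omap fst (a y) -> nabla x y.
  move=> Kx; have [i iE ->] := aP x Kx.
  have [/aK ->//|Ky] := pselect (K y).
  have [j jE ->] := aP y Ky => -[] /(congr1 val); rewrite iE jE.
  by move=> /fi -> //; rewrite ?inE; [exact: nR|exact: nC|exact: nC].
have na x y : nabla x y -> omap fst (a x) = omap fst (a y).
  move=> xy; have [Kx Ky] := op_supp op xy.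
  have [i iE ->] := aP x Kx; have [j jE ->] := aP y Ky.
  by congr Some; apply: val_inj; rewrite /= iE jE (nablaE xy).
have ad x y : ~ K x -> a x = a y -> delta x y.
  move=> Kx axy; have xy : nabla x y by apply: an; rewrite ?axy.
  have [_ Ky] := op_supp op xy; move: axy.
  have [i iE ->] := aP x Kx; have [j jE ->] := aP y Ky => -[_].
  rewrite -(nablaE xy) => /(proj1 (vP _ (nC x Kx))) -> //; first exact: dR.
  exact: nR.
have da x y : delta x y -> a x = a y.
  move=> xy; have [Kx Ky] := op_delta_supp xy.
  have /na := op_sub op xy.
  have [i iE ->] := aP x Kx; have [j jE ->] := aP y Ky => -[->].
  by rewrite (nablaE (op_sub op xy)) (deltaE xy).
have GK g x : perms G g -> K x -> K (g x).
  by move=> Gg Kx; rewrite -(op_fixed op Gg); exists x.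
have asurj z : exists x, a x = Some z.
  move: z => [i k]; have [C [x /= xx xC] Ci] := fs i (ltn_ord i).
  have Kx := (op_supp op xx).1.
  have [y] := (vP _ (nC x Kx)).2 k => xy yk.
  have [_ Ky] := op_supp op xy; have [j jE ay] := aP y Ky.
  exists y; rewrite ay -(nablaE xy) yk; congr (Some (_, _)); apply: val_inj.
  by rewrite /= jE -(nablaE xy) xC.
exists r, a; split; last first.
  move=> z; have [x ax] := asurj z.
  have Kx : ~ K x by move=> /aK; rewrite ax.
  exists x; first exact: dR.
  by apply/predeqP => y; rewrite /fiber /= -ax; split => [/da|/esym /(ad _ _ Kx)].
split.
- by apply: sub_finite_set (op_finite op) => x /aN.
- exact: asurj.
- by move=> g x Gg /aN Kx; apply: aK; exact: GK.
- move=> g x y Gg axy; have [Kx|Kx] := pselect (K x).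
    have /aN Ky : a y = None by rewrite -axy aK.
    by rewrite !aK//; exact: GK.
  by apply/da/dG => //; exact: ad.
- move=> g x y Gg axy; have [Kx|Kx] := pselect (K x).
    have /aN Ky : a y = None by move: axy; rewrite (aK x)//; case: (a y).
    by rewrite !aK//; exact: GK.
  by apply/na/nG => //; exact: an.
move=> i b bb.
have [C CC Ci] := fs i (ltn_ord i).
have aC x : omap fst (a x) = Some i <-> C x.
  have [z /= zz zC] := CC; have Kz := (op_supp op zz).1.
  have az : omap fst (a z) = Some i.
    have [j jE ->] := aP z Kz; congr Some; apply: val_inj => /=.
    by rewrite jE zC.
  by rewrite -zC -az; split=> [/esym /an -/(_ Kz)//|/na ->].
have := op_sym op CC.
pose rd := @relRestriction X delta C.
have CK x : C x -> ~ K x.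
  by move=> /aC ax /aK; move: ax; case: (a x).
have rdR y : rd y y by apply: dR; apply: CK; exact: set_valP.
have rdE y z : rd y z -> rd y = rd z.
  by move=> yz; apply/funext => w; rewrite /rd /relRestriction (deltaE yz).
have /choice[rep repP] : forall D : classes rd, exists y, rd y = val D.
  by move=> D; have [y _ yD] := set_valP D; exists y.
(* the numbering v, carried over to the classes of the restriction of delta to C *)
pose lbl (D : classes rd) := v C (delta (val (rep D))).
have rdC y : classes rd (rd y) by exists y => //=.
pose cl y : classes rd := insub_set (rdC y).
have nbC x : C x -> nabla x = C.
  by have [z _ <-] := CC => /nablaE.
have lblcl y : lbl (cl y) = v C (delta (val y)).
  rewrite /lbl; congr (v C); apply: deltaE.
  by have := rdR y; rewrite -{1}[rd y]/(val (cl y)) -repP.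
have lblb : bijective lbl.
  apply: inj_surj_bij => [D D' DD|k].
    apply: val_inj; rewrite -!repP; apply: rdE; rewrite /rd /relRestriction.
    rewrite ((vP C CC).1 _ _ (set_valP _) (set_valP _) DD).
    by apply: dR; apply: CK; exact: set_valP.
  have [x Cx xk] := (vP C CC).2 k.
  by exists (cl (insub_set Cx)); rewrite lblcl.
have [lbl' lK lK'] := lblb.
have : Sym (lbl' \o b \o lbl).
  by apply: bij_comp => //; apply: bij_comp => //; exists lbl.
move=> + opS; rewrite -opS => -[_ [g [_ [g0 [Gg0 g0C] gg0]] gP]].
exists g0; split=> //.
- move=> x k ax; have Cx : C x by apply/aC; rewrite ax.
  have := gP (cl (insub_set Cx)); set y := insub_set _ => /= yP.
  have : (g @` rd y) (g y) by exists y => //.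
  rewrite -yP -repP => gy.
  have Kx := CK _ Cx; have [_ Kgx] := op_delta_supp gy.
  have gyE : val (g y) = g0 x by rewrite gg0.
  have [j _ agx] := aP _ Kgx.
  have [j' _ ax'] := aP _ Kx.
  have Cgy := set_valP (g y).
  have : omap fst (a (val (g y))) = Some i by apply/aC.
  rewrite -gyE agx /= => -[->]; rewrite nbC// -(deltaE gy).
  congr (Some (i, _)).
  rewrite -[LHS]/(lbl _) lK' lblcl/=.
  by move: ax'; rewrite ax nbC// => -[_ <-].
- by move=> x xi; apply: g0C => Cx; apply: xi; apply/aC.
Qed.

End omega_to_addressing.

Section addressing_to_omega.
Variables (X : Type) (G : permGroup X) (I : finType) (a : X -> option (I * nat)).
Hypothesis ad : addressing G a.

Let K := [set x | a x = None].
Let nabla x y := omap fst (a x) = omap fst (a y) /\ ~ K x.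
Let delta x y := a x = a y /\ ~ K x.

Let K_idx x y : omap fst (a x) = omap fst (a y) -> K x -> K y.
Proof. by rewrite /K /=; case: (a x); case: (a y). Qed.

Let GK g x : perms G g -> K (g x) <-> K x.
Proof.
move=> Gg; split=> Kx; last exact: (ad_none ad Gg Kx).
by have := ad_none ad (perms_invf Gg) Kx; rewrite (permK Gg).
Qed.

Let delta_class Y : classes delta Y <-> exists z, Y = fiber a z.
Proof.
split.
  move=> [x [_ /= Kx] <-].
  case ax : (a x) => [z|]; last by case: Kx.
  exists z; apply/predeqP => y; rewrite /fiber /= /delta ax.
  by split=> [[]//|].
move=> [z ->]; have [x ax] := ad_surj ad z.
have Kx : ~ K x by rewrite /K /= ax.
exists x => //.
by apply/predeqP => y; rewrite /fiber /= /delta ax; split=> [[]//|].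
Qed.

Let nabla_class C : classes nabla C <->
  exists i, C = [set x | omap fst (a x) = Some i].
Proof.
split.
  move=> [x [_ /= Kx] <-].
  case ax : (a x) => [z|]; last by case: Kx.
  exists z.1; apply/predeqP => y; rewrite /= /nabla ax.
  by split=> [[]//|].
move=> [i ->]; have [x ax] := ad_surj ad (i, 0).
have Kx : ~ K x by rewrite /K /= ax.
exists x => //.
by apply/predeqP => y; rewrite /= /nabla ax; split=> [[]//|].
Qed.

Lemma addressing_omega : exists (K : set X) (nabla delta : X -> X -> Prop),
  omega_partition G K nabla delta /\
  forall Y, classes delta Y -> exists z, Y = fiber a z.
Proof.
exists K, nabla, delta; split; last by move=> Y /delta_class.
split.
- exact: ad_fin ad.
- move=> g Gg; apply/seteqP; split=> [_ [x Kx <-]|x Kx]; first exact/GK.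
  exists (invf g x); last exact: permKd Gg _.
  by apply: (GK _ Gg).1; rewrite (permKd Gg).
- by move=> x y [xy Kx]; split => // Ky; exact: (Kx (K_idx (esym xy) Ky)).
- by move=> x y [xy Kx]; split => //; rewrite xy.
- split.
  + by move=> x; split => //; exact: (set_valP x).
  + by move=> x y [xy _]; split => //; exact: (set_valP y).
  + by move=> x y z [xy Kx] [yz Ky]; split => //; rewrite xy.
  + move=> f [fb [g Gg gf]] x y [xy Kx]; rewrite /relRestriction !gf.
    by split; [exact: (ad_idx ad Gg xy) | rewrite GK].
- split.
  + by move=> x; split => //; exact: (set_valP x).
  + by move=> x y [xy _]; split => //; exact: (set_valP y).
  + by move=> x y z [xy Kx] [yz Ky]; split => //; rewrite xy.
  + move=> f [fb [g Gg gf]] x y [xy Kx]; rewrite /relRestriction !gf.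
    by split; [exact: (ad_eq ad Gg xy) | rewrite GK].
- apply: (@sub_finite_set _ _
    ((fun i => [set x | omap fst (a x) = Some i]) @` [set: I])).
    by move=> C /nabla_class[i ->]; exists i.
  exact/finite_image/finite_finset.
- move=> C /nabla_class[i ->].
  exists ((fun k => fiber a (i, k)) @` [set: nat]); split.
  + by move=> _ [k _ <-]; apply/delta_class; exists (i, k).
  + apply/card_set_bijP.
    pose u (Y : set X) : nat := xget 0 [set k | Y = fiber a (i, k)].
    have uE k : u (fiber a (i, k)) = k.
      rewrite /u; case: xgetP => [l _ kl|/(_ k)[]//].
      have [x ax] := ad_surj ad (i, k).
      have : fiber a (i, k) x by [].
      by rewrite kl /fiber /= ax => -[].
    exists u; split=> //.
    * by move=> _ _ /set_mem[k _ <-] /set_mem[l _ <-]; rewrite !uE => ->.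
    * by move=> k _; exists (fiber a (i, k)); rewrite ?uE//; exists k.
  + apply/predeqP => x /=; split.
      case ax : (a x) => [[j k]|//] /= [ji].
      exists (fiber a (i, k)); first by exists k.
      by rewrite /fiber /= ax ji.
    by move=> [_ [k _ <-]]; rewrite /fiber /= => ->.
move=> C /nabla_class[i Ci]; apply/seteqP; split=> f; first by case.
move=> fb.
pose rd := @relRestriction X delta C.
have CK x : C x -> ~ K x by rewrite Ci /K /=; case: (a x).
have rdE x y : rd x y <-> a (val x) = a (val y).
  by split=> [[]//|xy]; split=> //; apply: CK; exact: set_valP.
have exk k : exists x : C, a (val x) = Some (i, k).
  have [x ax] := ad_surj ad (i, k).
  have Cx : C x by rewrite Ci /= ax.
  by exists (insub_set Cx).
have /choice[pt ptP] := exk.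
have rdC y : classes rd (rd y) by exists y => //=; apply/rdE.
pose cl k : classes rd := insub_set (rdC (pt k)).
have aC (x : C) : exists k, a (val x) = Some (i, k).
  have Ci' y : C y -> omap fst (a y) = Some i by rewrite Ci.
  by have := Ci' _ (set_valP x); case: (a _) => // -[j k] [->]; exists k.
have clP (D : classes rd) k x : val D x -> a (val x) = Some (i, k) -> D = cl k.
  move=> Dx ax; apply: val_inj; have [y _ yD] := set_valP D.
  rewrite -yD in Dx *; apply/predeqP => w /=.
  by move/rdE : Dx => yx; rewrite !rdE ptP yx ax.
have clb : bijective cl.
  apply: inj_surj_bij => [k l kl|D].
    have : rd (pt k) (pt l).
      by rewrite -[rd _]/(val (cl k)) kl /=; apply/rdE.
    by move=> /rdE; rewrite !ptP => -[].
  have [y yy yD] := set_valP D; have [k yk] := aC y.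
  by exists k; apply/esym/(clP _ _ y) => //; rewrite -yD.
have [cl' clK clK'] := clb.
pose b := cl' \o f \o cl.
have bb : bijective b.
  by apply: bij_comp => //; apply: bij_comp => //; exists cl.
have [g [Gg gb gC]] := ad_sym ad i bb.
have gC' x : ~ C x -> g x = x by rewrite Ci => /gC.
have [h hG hg] := localGroup_ex Gg gC'.
split => //; exists h => // D.
have [x xx xD] := set_valP D; have [k xk] := aC x.
have Dk : D = cl k by apply: (clP _ _ x) => //; rewrite -xD.
have fD : f D = cl (b k) by rewrite /b /= clK' Dk.
rewrite fD; apply/predeqP => y; rewrite -[val (cl (b k))]/(rd (pt (b k))).
rewrite rdE ptP; split.
  move=> /esym yb; exists (invf h y); last exact: permKd hG _.
  have [l yl] := aC (invf h y).
  have := gb _ _ yl; rewrite -hg (permKd hG) yb => -[/(bij_inj bb) kl].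
  by rewrite Dk /= rdE ptP yl kl.
move=> [w Dw <-]; rewrite hg (gb _ k)//.
by move: Dw; rewrite Dk /= rdE ptP.
Qed.

End addressing_to_omega.

Lemma HpredS_intro n X (G : permGroup X) (I : finType) (a : X -> option (I * nat)) :
  pclosed G -> addressing G a -> (forall z, Hpred n (localGroup G (fiber a z))) ->
  Hpred n.+1 G.
Proof.
move=> cG aG aH; split; first exact/closed_groupP.
have [K [nabla [delta [op dP]]]] := addressing_omega aG.
by exists K, nabla, delta; split=> // Y /dP[z ->].
Qed.

Lemma HpredS_elim n X (G : permGroup X) : Hpred n.+1 G ->
  pclosed G /\ exists (r : nat) (a : X -> option ('I_r * nat)),
    addressing G a /\ forall z, Hpred n (localGroup G (fiber a z)).
Proof.
move=> [/closed_groupP cG [K [nabla [delta [op dP]]]]]; split => //.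
have [r [a [aG ad]]] := omega_addressing op.
by exists r, a; split=> // z; exact: dP.
Qed.

Lemma Hpred_pclosed n X (G : permGroup X) : Hpred n G -> pclosed G.
Proof. by case: n => // n [/closed_groupP]. Qed.

Lemma HpredW n X (G : permGroup X) : Hpred n G -> Hpred n.+1 G.
Proof.
elim: n X G => // n IHn X G [cG [K [nabla [delta [op dP]]]]].
by split=> //; exists K, nabla, delta; split=> // Y /dP; exact: IHn.
Qed.

Lemma Hpred_leq m n X (G : permGroup X) : m <= n -> Hpred m G -> Hpred n G.
Proof.
move=> /subnK <-; elim: (n - m) => // k IHk /IHk.
by rewrite addSn; exact: HpredW.
Qed.

(** All points can be put into K. *)
Lemma Hpred_finite X (G : permGroup X) : finite_set [set: X] -> Hpred 1 G.
Proof.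
move=> fX; apply: (@HpredS_intro _ _ _ 'I_0 (fun=> None)).
- move=> f fb /(_ setT fX)[g Gg fg].
  by have -> : f = g by apply/funext => x; exact: fg.
- split=> //; last by case.
    by apply: sub_finite_set fX.
  by case; case.
- by case; case.
Qed.

(** The pattern for all identifications of local groups: [i] parametrises Y by T. *)
Lemma localGroup_iso X T (G : permGroup X) (Y : set X) (M : permGroup T)
    (i : T -> X) : injective i -> (forall x, Y x <-> exists t, i t = x) ->
  (forall m, perms M m -> exists g, [/\ perms G g, forall x, ~ Y x -> g x = x &
     forall t, g (i t) = i (m t)]) ->
  (forall g, perms G g -> (forall x, ~ Y x -> g x = x) ->
     exists2 m, perms M m & forall t, g (i t) = i (m t)) ->
  isomorphic (DPermGroup M) (DPermGroup (localGroup G Y)).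
Proof.
move=> ii iY MG GM; apply/isomorphicP.
have Yi t : Y (i t) by apply/iY; exists t.
have /choice[e' e'P] : forall y : Y, exists t, i t = val y.
  by move=> y; apply/iY; exact: set_valP.
pose e t : Y := insub_set (Yi t).
have eK : cancel e e' by move=> t; apply: ii; rewrite e'P.
have eK' : cancel e' e by move=> y; apply: val_inj; rewrite /= e'P.
exists e, e'; split=> // f; split.
  move=> [fb [g [Gg gY] fg]].
  have [m Mm gm] := GM g Gg gY.
  rewrite (_ : _ \o _ = m)//; apply/funext => t /=; apply: ii.
  by rewrite e'P fg /= gm.
set m := _ \o _ => Mm; have [g [Gg gY gm]] := MG m Mm.
split.
  have -> : f = e \o m \o e'.
    by apply/funext => y; rewrite /m /= !eK'.
  apply: bij_comp; last by exists e.
  by apply: bij_comp (perms_bij Mm); exists e'.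
exists g => // y; rewrite -(eK' y) /= gm.
by rewrite -[i _]/(val (e _)) /m /= eK'.
Qed.

Lemma Hpred_iso n X Y (G : permGroup X) (H : permGroup Y) :
  isomorphic (DPermGroup G) (DPermGroup H) -> Hpred n G -> Hpred n H.
Proof.
elim: n X Y G H => // n IHn X Y G H GH /HpredS_elim[cG [r [a [aG aP]]]].
have cH := pclosed_iso GH cG.
have /isomorphicP[e [e' [eK eK' GHe]]] := GH.
have He g : perms H g -> exists2 g', perms G g' & forall x, e' (g x) = g' (e' x).
  by move=> /GHe Gg; exists (e' \o g \o e) => // x /=; rewrite eK'.
have Ge g : perms G g -> exists2 g', perms H g' & forall x, g' x = e (g (e' x)).
  move=> Gg; exists (e \o g \o e') => //; apply/GHe.
  by rewrite (_ : _ \o _ = g)//; apply/funext => x /=; rewrite !eK.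
apply: (HpredS_intro (a := a \o e')) => //.
  split.
  - apply: (sub_finite_set _ (finite_image e (ad_fin aG))) => y /= ay.
    by exists (e' y) => //=; rewrite eK'.
  - by move=> z; have [x xz] := ad_surj aG z; exists (e x); rewrite /= eK.
  - by move=> g x /He[g' Gg' gg'] /=; rewrite gg'; exact: (ad_none aG).
  - by move=> g x y /He[g' Gg' gg'] /=; rewrite !gg'; exact: (ad_eq aG).
  - by move=> g x y /He[g' Gg' gg'] /=; rewrite !gg'; exact: (ad_idx aG).
  - move=> i b /(ad_sym aG i)[g [/Ge[g' Hg' gg'] gb gi]].
    exists g'; split=> // [x k /= xk|x xi]; first by rewrite gg' eK; exact: gb.
    by rewrite gg' gi ?eK'.
move=> z; apply: (IHn _ _ (localGroup G (fiber a z))); last exact: aP.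
apply: (@localGroup_iso _ _ _ _ _ (e \o val)).
- by move=> t u /= /(can_inj eK) /val_inj.
- move=> y; split=> [ay|[t <-]].
    by exists (insub_set (ay : fiber a z (e' y))); rewrite /= eK'.
  by rewrite /fiber /= eK; exact: (set_valP t).
- move=> m [_ [g [Gg gz] mg]]; have [g' Hg' gg'] := Ge g Gg.
  exists g'; split=> // [x xz|t]; first by rewrite gg' gz ?eK'.
  by rewrite gg' /= eK mg.
- move=> g Hg gz; have [g' Gg' gg'] := He g Hg.
  have [|m mG mg] := @localGroup_ex _ _ g' (fiber a z) Gg'.
    by move=> x xz; have := gg' (e x); rewrite gz ?eK// /fiber /= eK.
  exists m => // t; have := gg' (e (val t)).
  by rewrite /= eK -mg => <-; rewrite eK'.
Qed.

(** * Block groups *)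

Lemma invf_fix X (f : X -> X) x : bijective f -> f x = x -> invf f x = x.
Proof. by move=> fb fx; rewrite -{1}fx invfK. Qed.

Lemma inv_invf X (f : X -> X) : involutive f -> invf f = f.
Proof. by move=> fK; exact: invf_eq. Qed.

Lemma finite_sub1 (T : Type) (A : set T) : (forall x y, A x -> A y -> x = y) -> finite_set A.
Proof.
move=> A1; have [[x Ax]|A0] := pselect (exists x, A x).
  by apply: (sub_finite_set _ (finite_set1 x)) => y Ay; exact: A1.
by apply: (sub_finite_set _ (finite_set0 T)) => y Ay; apply: A0; exists y.
Qed.

Lemma two_cofinite (A B : set nat) : finite_set (~` A) -> finite_set (~` B) ->
  exists n, A n /\ B n.
Proof.
move=> fA fB; apply: contrapT => /forallNP AB; apply: infinite_nat.
apply: (@sub_finite_set _ _ (~` A `|` ~` B)); last by rewrite finite_setU.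
by move=> n _; have /not_andP := AB n.
Qed.

Definition swapn (k l n : nat) : nat :=
  if n == k then l else if n == l then k else n.

Lemma swapnL k l : swapn k l k = l. Proof. by rewrite /swapn eqxx. Qed.
Lemma swapnR k l : swapn k l l = k.
Proof. by rewrite /swapn eqxx; case: eqP. Qed.
Lemma swapnD k l n : n <> k -> n <> l -> swapn k l n = n.
Proof. by rewrite /swapn; do 2! case: eqP => //. Qed.
Lemma swapnK k l : involutive (swapn k l).
Proof.
move=> n; have [->|nk] := pselect (n = k); first by rewrite swapnL swapnR.
have [->|nl] := pselect (n = l); first by rewrite swapnR swapnL.
by rewrite !(swapnD nk nl).
Qed.
Lemma swapn_bij k l : bijective (swapn k l).
Proof. exact: inv_bij (@swapnK k l). Qed.

Section blocks.
Variables (s r : nat) (T : 'I_r -> Type) (M : forall i, permGroup (T i)).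

(** The copies of the types [T i] are called fibres below, the union of all copies
    of one [T i] a factor, and the elements of ['I_s] isolated points. *)
Definition blockDom : Type := ('I_s + {i : 'I_r & (T i * nat)%type})%type.

Definition pt i (x : T i) (k : nat) : blockDom :=
  inr (existT (fun i => (T i * nat)%type) i (x, k)).

Definition addr (p : blockDom) : option ('I_r * nat) :=
  match p with inl _ => None | inr (existT i xk) => Some (i, xk.2) end.

Definition act (al : forall i, nat -> T i -> T i) (be : 'I_r -> nat -> nat)
    (p : blockDom) : blockDom :=
  match p with
  | inl t => inl t
  | inr (existT i xk) => pt (al i xk.2 xk.1) (be i xk.2)
  end.

Lemma blockP (p : blockDom) :
  (exists t, p = inl t) \/ exists i x k, p = @pt i x k.
Proof.
by case: p => [t|[i [x k]]]; [left; exists t | right; exists i, x, k].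
Qed.

Lemma addr_pt p i k : addr p = Some (i, k) -> exists x, p = @pt i x k.
Proof. by case: p => // -[j [x l]] /= [<- <-]; exists x. Qed.

Lemma addr_inl p : addr p = None -> exists t, p = inl t.
Proof. by case: p => [t _|[? []]//]; exists t. Qed.

Lemma pt_inj i (x y : T i) k l : pt x k = pt y l -> x = y /\ k = l.
Proof.
move=> /(congr1 (fun p => if p is inr u then u else
  existT (fun i => (T i * nat)%type) i (x, k))) /= xy.
by have [] := existT_inj xy.
Qed.

Lemma act_comp al be al' be' :
  act al be \o act al' be' =
  act (fun i k => al i (be' i k) \o al' i k) (fun i => be i \o be' i).
Proof. by apply/funext => -[t|[i [x k]]]. Qed.

Lemma act_id : act (fun _ _ => id) (fun _ => id) = id.
Proof. by apply/funext => -[t|[i [x k]]]. Qed.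

Lemma act_ext al be al' be' : (forall i k x, al i k x = al' i k x) ->
  (forall i k, be i k = be' i k) -> act al be = act al' be'.
Proof. by move=> ab be_; apply/funext => -[t|[i [x k]]] //=; rewrite ab be_. Qed.

Lemma act_can al be al' be' : (forall i, cancel (be i) (be' i)) ->
  (forall i k, cancel (al i k) (al' i (be i k))) ->
  cancel (act al be) (act al' be').
Proof. by move=> bK aK [t|[i [x k]]] //=; rewrite /pt/= bK aK. Qed.

Definition act_inv_al (al : forall i, nat -> T i -> T i) (be : 'I_r -> nat -> nat) :=
  fun i k => invf (al i (invf (be i) k)).

Lemma act_inv al be : (forall i, bijective (be i)) ->
  (forall i k, bijective (al i k)) ->
  cancel (act al be) (act (act_inv_al al be) (fun i => invf (be i))) /\
  cancel (act (act_inv_al al be) (fun i => invf (be i))) (act al be).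
Proof.
move=> bb ab; split; apply: act_can => i.
- exact: invfK.
- by move=> k x; rewrite /act_inv_al invfK ?invfK.
- exact: invfKd.
- by move=> k x; rewrite /act_inv_al invfKd.
Qed.

(** The product of the identity group on ['I_s] and of the wreath products of the
    [M i] with Sym(omega). *)
Program Definition blockGroup : permGroup blockDom :=
  @PermGroup blockDom [set f | exists al be, [/\ forall i, bijective (be i),
    forall i k, perms (M i) (al i k) & f = act al be]] _ _ _ _.
Next Obligation.
move=> f [al [be [bb aM ->]]].
have [aK aK'] := act_inv bb (fun i k => perms_bij (aM i k)).
by exists (act (act_inv_al al be) (fun i => invf (be i))).
Qed.
Next Obligation.
exists (fun _ _ => id), (fun _ => id); split.
- by move=> i; exists id.
- by move=> i k; exact: perms_id.
- by rewrite act_id.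
Qed.
Next Obligation.
move=> _ _ [al [be [bb aM ->]]] [al' [be' [bb' aM' ->]]].
rewrite /= act_comp; exists (fun i k => al i (be' i k) \o al' i k), (fun i => be i \o be' i).
split=> //.
- by move=> i; exact: bij_comp.
- by move=> i k; exact: perms_comp.
Qed.
Next Obligation.
move=> _ g [al [be [bb aM ->]]] fg gf.
have [aK aK'] := act_inv bb (fun i k => perms_bij (aM i k)).
exists (act_inv_al al be), (fun i => invf (be i)); split.
- by move=> i; exact: invf_bij.
- by move=> i k; exact: perms_invf.
- by apply/funext => x; rewrite -{1}(aK' x) fg.
Qed.

Notation W := (perms blockGroup).

Lemma block_addr f p q : W f -> addr p = addr q -> addr (f p) = addr (f q).
Proof.
by move=> [al [be [_ _ ->]]]; case: p => [t|[i [x k]]]; case: q => [u|[j [y l]]] //= -[<- <-].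
Qed.

Lemma block_idx f p : W f -> omap fst (addr (f p)) = omap fst (addr p).
Proof. by move=> [al [be [_ _ ->]]]; case: p => [t|[i [x k]]]. Qed.

Lemma block_addr_inj f p q : W f -> addr (f p) = addr (f q) -> addr p = addr q.
Proof.
move=> Wf /(block_addr (perms_invf Wf)).
by rewrite !(permK Wf).
Qed.

Lemma block_pt f i k : W f -> exists2 m, perms (M i) m &
  exists l, forall x, f (@pt i x k) = pt (m x) l.
Proof.
by move=> [al [be [_ aM ->]]]; exists (al i k) => //; exists (be i k).
Qed.

(** Two kinds of elements of a block group suffice below: [permE] permutes the
    fibres of one factor, [oneE] acts in a single fibre. *)
Definition permE i (b : nat -> nat) : blockDom -> blockDom :=
  act (fun _ _ => id) (fun j => if j == i then b else id).

Definition swapE i k l := permE i (swapn k l).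

Definition one_al i (k : nat) (m : T i -> T i) : forall j, nat -> T j -> T j :=
  dfwith (T := fun j => nat -> T j -> T j) (fun _ _ => id) i
    (fun l => if l == k then m else id).

Definition oneE i k (m : T i -> T i) : blockDom -> blockDom :=
  act (one_al k m) (fun _ => id).

Lemma permE_block i b : bijective b -> W (permE i b).
Proof.
move=> bb; exists (fun _ _ => id), (fun j => if j == i then b else id); split=> //.
- by move=> j /=; case: ifP => // _; exists id.
- by move=> j k; exact: perms_id.
Qed.

Lemma permE_in i b x k : permE i b (@pt i x k) = pt x (b k).
Proof. by rewrite /permE /= eqxx. Qed.

Lemma permE_out i b p : omap fst (addr p) <> Some i -> permE i b p = p.
Proof.
case: p => [t|[j [x k]]] //= ji; case: eqP => // ji'.
by case: ji; rewrite ji'.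
Qed.

Lemma swapE_block i k l : W (swapE i k l).
Proof. exact/permE_block/swapn_bij. Qed.

Lemma swapE_out i k l p : addr p <> Some (i, k) -> addr p <> Some (i, l) ->
  swapE i k l p = p.
Proof.
case: p => [t|[j [x n]]] //= nk nl; rewrite /swapE /permE /= /pt.
case: eqP nk nl => // ji nk nl.
by rewrite swapnD// => E; [apply: nk|apply: nl]; rewrite ji E.
Qed.

Lemma swapEK i k l : involutive (swapE i k l).
Proof.
move=> [t|[j [x n]]] //=; rewrite /swapE /permE/= /pt.
by case: eqP => // _; rewrite swapnK.
Qed.

Lemma swapE2_in i j k l (v : T i) : k <> l -> l <> j ->
  (swapE i j k \o swapE i j l) (pt v j) = pt v l.
Proof.
move=> kl lj; rewrite /comp [swapE i j l _]permE_in swapnL [LHS]permE_in.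
by rewrite swapnD//; exact/nesym.
Qed.

Lemma swapE2_out i j k l p : addr p <> Some (i, j) -> addr p <> Some (i, k) ->
  addr p <> Some (i, l) -> (swapE i j k \o swapE i j l) p = p.
Proof. by move=> pj pk pl; rewrite /comp !swapE_out. Qed.

Lemma oneE_block i k m : perms (M i) m -> W (oneE k m).
Proof.
move=> mM; exists (one_al k m), (fun _ => id).
split=> // [j|j l]; first by exists id.
rewrite /one_al; case: dfwithP => [|j' _]; last exact: perms_id.
by case: eqP => // _; exact: perms_id.
Qed.

Lemma oneE_in i k m x : oneE k m (@pt i x k) = pt (m x) k.
Proof. by rewrite /oneE /= /one_al dfwithin eqxx. Qed.

Lemma oneE_out i k (m : T i -> T i) p : addr p <> Some (i, k) -> oneE k m p = p.
Proof.
case: p => [t|[j [x n]]] //= jk; rewrite /oneE /= /pt /one_al.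
have [ji|ij] := eqVneq i j; last by rewrite dfwithout.
by case: j / ji x jk => x jk; rewrite dfwithin; case: eqP => // nk; case: jk; rewrite nk.
Qed.

(** * Permutations that commensurate a block group *)

(** The only property of a permutation that is used to show that it respects
    the fibres: a consequence of the pigeonhole principle both for the elements of
    a finite index supergroup of W and for those that normalise one. *)
Definition commensurates (g : blockDom -> blockDom) : Prop :=
  forall w : nat -> blockDom -> blockDom, (forall k, W (w k)) ->
  forall B : set nat, infinite_set B ->
  exists k l, [/\ B k, B l, k <> l & W (g \o (invf (w k) \o w l) \o invf g)].

Lemma commensurates_swap g i j (B : set nat) : commensurates g -> infinite_set B ->
  exists k l, [/\ B k, B l, k <> l &
    W (g \o (swapE i j k \o swapE i j l) \o invf g)].
Proof.
move=> cg Binf; have [k [l [Bk Bl kl]]] := cg _ (swapE_block i j) B Binf.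
by rewrite (inv_invf (@swapEK i j k)) => Wg; exists k, l.
Qed.

Lemma infinite_neq n : infinite_set [set k : nat | k <> n].
Proof.
apply: (@sub_infinite_set _ ([set: nat] `\` [set n])).
  by move=> k [_ kn].
exact: infinite_setD infinite_nat (finite_set1 n).
Qed.

(** If [g] moved a point of some factor to an isolated point, then swaps of that
    factor, which move the former, would be conjugate to elements of W, which
    fix the latter. *)
Lemma commensurates_none g p : bijective g -> commensurates g ->
  addr p = None -> addr (invf g p) = None.
Proof.
move=> gb cg /addr_inl[t ->].
case: (blockP (invf g (inl t))) => [[u -> //]|[i [v [j gt]]]].
have [k [l [/= kj lj kl [al [be [_ _ wE]]]]]] :=
  commensurates_swap i j cg (infinite_neq (n := j)).
have : (g \o (swapE i j k \o swapE i j l) \o invf g) (inl t) = inl t by rewrite wE.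
rewrite -compA /comp -/((swapE i j k \o swapE i j l) _) gt swapE2_in//.
by move=> /(congr1 (invf g)); rewrite (invfK gb) gt => /pt_inj[].
Qed.

Section commensurator.
Variable g : blockDom -> blockDom.
Hypotheses (gb : bijective g) (cg : commensurates g) (cg' : commensurates (invf g)).

Let gKd := invfKd gb.
Let gK := invfK gb.

(** [S c] is the image under [g] of the fibre with address [c]. *)
Let S c p := addr (invf g p) = Some c.

(** An element [u] of W that is conjugate into W by [g] permutes the images of
    the fibres, so it preserves one as soon as it keeps one of its points there. *)
Let S_stable c u z z' : W (invf g \o u \o g) -> S c z -> S c (u z) -> S c z' ->
  S c (u z').
Proof.
rewrite /S => Wu zc uzc zc'; rewrite -uzc.
have := block_addr Wu (etrans zc' (esym zc)).
by rewrite /= !gKd.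
Qed.

(** Suppose that the image of a fibre contains [p] and [pt v j], not in one fibre.
    Swapping fibre j with fibres k and l fixes [p], so it preserves the image,
    while it carries [pt v j] to [pt v l]. *)
Let S_swap c i j v p : S c p -> S c (pt v j) -> addr p <> Some (i, j) ->
  finite_set [set k | ~ S c (@pt i v k)].
Proof.
move=> Sp Sq pj; apply: contrapT => bad.
pose F := [set j] `|` [set k | addr p = Some (i, k)].
have finF : finite_set F.
  rewrite finite_setU; split; first exact: finite_set1.
  by apply: finite_sub1 => k l /= -> [].
have [k [l [[Sk Fk] [Sl Fl] kl]]] :=
  commensurates_swap i j cg' (infinite_setD bad finF).
rewrite (invfV gb) => Wu; apply: Sl.
have := S_stable Wu Sp _ Sq; rewrite swapE2_in//; last by move=> lj; apply: Fl; left.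
by apply; rewrite swapE2_out//; move=> pE; [apply: Fk|apply: Fl]; right.
Qed.

(** Now the elements that act by [m] in one fibre serve to leave the point [v]; they
    fix [pt v j]. *)
Let S_image c i j v p m : S c p -> S c (pt v j) -> addr p <> Some (i, j) ->
  perms (M i) m -> finite_set [set k | ~ S c (@pt i (m v) k)].
Proof.
move=> Sp Sq pj Mm; apply: contrapT => bad.
have finF : finite_set ([set j] `|` [set k | ~ S c (@pt i v k)]).
  rewrite finite_setU; split; first exact: finite_set1.
  exact: S_swap Sp Sq pj.
have [k [l [[Sk Fk] [Sl Fl] kl]]] :=
  cg' (fun k => oneE_block k Mm) (infinite_setD bad finF).
rewrite (invfV gb) => Wu; apply: Sl.
have ob n : bijective (oneE n m) by apply: perms_bij (oneE_block n Mm).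
have jl : j <> l by move=> jl; apply: Fl; left.
have jk : j <> k by move=> jk; apply: Fk; left.
have inv_out n x : addr x <> Some (i, n) -> invf (oneE n m) x = x.
  by move=> xn; apply: invf_fix => //; exact: oneE_out.
have := S_stable Wu Sq; rewrite /comp oneE_out; last by case.
rewrite inv_out; last by case.
move=> /(_ (pt v l)); rewrite oneE_in inv_out; last by case=> /nesym.
by apply=> //; apply: contrapT => Svl; apply: Fl; right.
Qed.

(** Were the image of a fibre to meet two fibres, it would by [S_image] contain
    almost all copies of each point of an orbit of M_i.  So would its translate
    under a suitable element of W, which is the image of another fibre; but two
    images are disjoint. *)
Lemma commensurates_addr p q : addr p = addr q -> addr (g p) = addr (g q).
Proof.
case pc : (addr p) => [[i0 k0]|] qc; last first.
  have := commensurates_none (invf_bij gb) cg' pc.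
  have := commensurates_none (invf_bij gb) cg' (esym qc).
  by rewrite (invfV gb) => -> ->.
apply: contrapT => pq.
have Sp : S (i0, k0) (g p) by rewrite /S gK.
have Sq : S (i0, k0) (g q) by rewrite /S gK.
case: (blockP (g q)) => [[t gqt]|[i [v [j gq]]]].
  have := @commensurates_none g (g q) gb cg; rewrite gK -qc.
  by rewrite gqt => /(_ erefl).
have [k [l [/= kk lk kl Wr]]] := commensurates_swap i0 k0 cg (infinite_neq (n := k0)).
(* rho is in W and maps the image of the fibre k0 to that of the fibre l *)
set rho := g \o _ \o _ in Wr.
have S'P x : addr x = Some (i0, k0) -> S (i0, l) (rho (g x)).
  move=> /addr_pt[x' ->]; rewrite /S /rho -compA /comp !gK.
  by rewrite -/((swapE i0 k0 k \o swapE i0 k0 l) _) swapE2_in.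
have [m Mm [j' mE]] := block_pt i j Wr.
have qE : rho (g q) = pt (m v) j' by rewrite gq mE.
have S'q : S (i0, l) (pt (m v) j') by rewrite -qE; exact: S'P.
have gpj : addr (g p) <> Some (i, j) by rewrite gq in pq.
have gpj' : addr (rho (g p)) <> Some (i, j').
  rewrite -[Some _]/(addr (pt (m v) j')) -qE => /(block_addr_inj Wr); exact: pq.
have fS' := S_image (S'P p pc) S'q gpj' (perms_invf Mm).
rewrite gq in Sq.
have fS := S_swap Sp Sq gpj.
have [n [Sn S'n]] := two_cofinite fS fS'.
by move: S'n; rewrite (permK Mm) /S Sn => -[/esym].
Qed.

(** Almost all fibres of a factor go into the same factor as a given one, because
    the swaps do not leave the factors. *)
Lemma commensurates_idx p q : omap fst (addr p) = omap fst (addr q) ->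
  omap fst (addr (g p)) = omap fst (addr (g q)).
Proof.
case: (blockP p) => [[t ->]|[i [x [k ->]]]]; case: (blockP q) => [[u ->]|[j [y [l ->]]]]//=.
  by move=> _; rewrite (@commensurates_addr (inl t) (inl u)).
move=> [ji]; case: j / ji y => y.
have fin n z : finite_set [set a |
    ~ omap fst (addr (g (@pt i z a))) = omap fst (addr (g (pt z n)))].
  apply: contrapT => bad.
  have [a [b [[ba _] [bb /= bn] ab Wr]]] :=
    commensurates_swap i n cg (infinite_setD bad (finite_set1 n)).
  apply: bb; have := block_idx (g (pt z n)) Wr; rewrite -compA /comp gK.
  by rewrite -/((swapE i n a \o swapE i n b) _) swapE2_in.
have [a [ka la]] := two_cofinite (fin k x) (fin l x).
rewrite -ka la; congr omap.
exact: commensurates_addr.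
Qed.

End commensurator.

End blocks.
Arguments pt {s r T i}.
Arguments pt_inj {s r T i x y k l}.
Arguments addr {s r T}.
Arguments swapE {s r T}.
Arguments permE {s r T}.

(** * Finite index supergroups of block groups *)

Lemma finite_index_local X (G G' : permGroup X) (Y : set X) :
  perms G `<=` perms G' -> fin_index (perms G') (perms G) ->
  perms (localGroup G Y) `<=` perms (localGroup G' Y) /\
  fin_index (perms (localGroup G' Y)) (perms (localGroup G Y)).
Proof.
move=> GG' [C [col colP]]; split.
  by move=> f [fb [g [Gg gY] fg]]; split=> //; exists g => //; split => //; exact: GG'.
have /choice[ext extP] : forall f : Y -> Y, exists g, perms (localGroup G' Y) f ->
    [/\ perms G' g, forall x, ~ Y x -> g x = x & forall y, val (f y) = g (val y)].
  move=> f; have [[fb [g [Gg gY] fg]]|nf] := pselect (perms (localGroup G' Y) f).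
    by exists g.
  by exists id.
exists C, (col \o ext) => p q Lp Lq pq.
have [Gp pY pE] := extP _ Lp; have [Gq qY qE] := extP _ Lq.
split; first exact: bij_comp (invf_bij (perms_bij Lp)) (perms_bij Lq).
exists (invf (ext p) \o ext q).
  split; first exact: colP.
  by move=> x Yx; rewrite /= qY// invf_fix ?pY//; exact: perms_bij Gp.
move=> y; apply: (perm_injective Gp); rewrite -pE /= (permKd Lp) (permKd Gp).
exact: qE.
Qed.

Section block_supergroups.
Variables (s r : nat) (T : 'I_r -> Type) (M : forall i, permGroup (T i)).
Variable x0 : forall i, T i.

Notation D := (blockDom s T).
Notation W := (perms (blockGroup s M)).

(** The parameters of a limit of elements of W are read off at the base points
    [x0 i]. *)
Lemma pclosed_blockGroup : (forall i, pclosed (M i)) -> pclosed (blockGroup s M).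
Proof.
move=> cM f fb fA.
have f1 p q : exists2 g, W g & f p = g p /\ f q = g q.
  have [g Wg gf] := fA [set p; q] (finite_set2 p q).
  by exists g => //; split; apply: gf; [left|right].
have f_inl t : f (inl t) = inl t.
  by have [g [al [be [_ _ ->]]] [-> _]] := f1 (inl t) (inl t).
have f_idx p : omap fst (addr (f p)) = omap fst (addr p).
  by have [g Wg [-> _]] := f1 p p; exact: block_idx Wg.
have beP i : exists b : nat -> nat, forall x k, addr (f (@pt s r T i x k)) = Some (i, b k).
  have [b bP] : exists b : nat -> nat, forall k, addr (f (pt (x0 i) k)) = Some (i, b k).
    have /choice[b bP] : forall k, exists l, addr (f (pt (x0 i) k)) = Some (i, l).
      move=> k; have := f_idx (pt (x0 i) k); case: (addr _) => [[j l] [->]|//].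
      by exists l.
    by exists b.
  exists b => x k; rewrite -bP; have [g Wg [-> ->]] := f1 (pt x k) (pt (x0 i) k).
  exact: block_addr Wg _.
pose be i := projT1 (cid (beP i)).
have beE i x k : addr (f (@pt s r T i x k)) = Some (i, be i k).
  by rewrite /be; case: cid => b /= ->.
have alP i : exists al : nat -> T i -> T i, forall x k, f (pt x k) = pt (al k x) (be i k).
  have /choice[al alP] : forall xk : T i * nat, exists y : T i, f (pt xk.1 xk.2) = pt y (be i xk.2).
    by move=> [x k]; apply/addr_pt; rewrite beE.
  by exists (fun k x => al (x, k)) => x k; rewrite (alP (x, k)).
pose al i := projT1 (cid (alP i)).
have alE i x k : f (@pt s r T i x k) = pt (al i k x) (be i k).
  by rewrite /al; case: cid => b /= ->.
have [f' fK fK'] := fb.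
have f'_pt i (x : T i) k : exists (y : T i) l, f (pt y l) = pt x k.
  case: (blockP (f' (pt x k))) => [[t]|[j [y [l E]]]].
    by move=> /(congr1 f); rewrite fK' f_inl.
  have := congr1 f E; rewrite fK' => E'.
  have : i = j by have := f_idx (pt y l); rewrite -E' => -[].
  by move=> ij; case: j / ij y E E' => y _ E'; exists y, l.
have be_bij i : bijective (be i).
  apply: inj_surj_bij => [k l kl|l].
    have [g [al' [be' [bb _ ->]]] [gk gl]] := f1 (pt (x0 i) k) (pt (x0 i) l).
    have := beE i (x0 i) k; rewrite gk => -[bk].
    have := beE i (x0 i) l; rewrite gl => -[bl].
    by apply: (bij_inj (bb i)); rewrite bk bl.
  have [y [k yk]] := f'_pt i (x0 i) l; exists k.
  by have := beE i y k; rewrite yk => -[].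
exists al, be; split=> //; last first.
  by apply/funext => -[t|[i [x k]]]; [exact: f_inl | exact: alE].
move=> i k; apply: cM.
  apply: inj_surj_bij => [x y xy|y].
    have : f (pt x k) = f (pt y k) by rewrite !alE xy.
    by move=> /(can_inj fK) /pt_inj[].
  have [x [l xl]] := f'_pt i y (be i k); exists x.
  move: xl; rewrite alE => /pt_inj[<-] /(bij_inj (be_bij i)) ->.
  by [].
move=> A finA; have [g Wg gf] := fA [set pt x k | x in A] (finite_image _ finA).
have [m Mm [l mE]] := block_pt i k Wg; exists m => // x Ax.
have := gf (pt x k) (imageP _ Ax).
by rewrite alE mE => /pt_inj[].
Qed.

Lemma block_local i k :
  isomorphic (DPermGroup (M i)) (DPermGroup (localGroup (blockGroup s M) (fiber addr (i, k)))).
Proof.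
apply: (@localGroup_iso _ _ _ _ _ (fun x => @pt s r T i x k)).
- by move=> x y /pt_inj[].
- by move=> p; split=> [/addr_pt[x ->]|[x <-]//]; exists x.
- move=> m Mm; exists (@oneE s r T i k m); split; first exact: oneE_block.
    by move=> p pk; exact: oneE_out.
  by move=> x; exact: oneE_in.
- move=> g Wg gS; have [m Mm [l mE]] := block_pt i k Wg; exists m => // x.
  have : addr (g (pt x k)) = Some (i, k).
    exact: (@supp_stable _ g (fiber addr (i, k)) (perm_injective Wg) gS).
  by rewrite mE => -[->].
Qed.

Variable G : permGroup D.
Hypotheses (WG : W `<=` perms G) (WGfin : fin_index (perms G) W).

(** Stated for all [g] that conjugate W into G, so that it applies both to the
    elements of G and to its normaliser. *)
Lemma fin_index_commensurates g :
  (forall w, W w -> perms G (g \o w \o invf g)) -> bijective g ->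
  commensurates M g.
Proof.
move=> gG gb w Ww B Binf; have [C [col colP]] := WGfin.
have [k [l [Bk Bl kl]]] := infinite_pigeonhole (fun k => col (g \o w k \o invf g)) Binf.
move=> /(colP _ _ (gG _ (Ww k)) (gG _ (Ww l))) Wkl; exists k, l; split=> //.
have wK := permK (Ww k); have wKd := permKd (Ww k).
have gK := invfK gb; have gKd := invfKd gb.
move: Wkl; rewrite (@invf_eq _ _ (g \o invf (w k) \o invf g)).
- congr (W _); apply/funext => x /=; by rewrite gK.
- by move=> x; rewrite /= gK wK gKd.
- by move=> x; rewrite /= gK wKd gKd.
Qed.

Lemma supergroup_commensurates g : perms G g -> commensurates M g /\ commensurates M (invf g).
Proof.
have cG h : perms G h -> commensurates M h.
  move=> Gh; apply: fin_index_commensurates => //; last exact: perms_bij Gh.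
  move=> w Ww; apply: perms_comp (perms_invf Gh).
  by apply: perms_comp => //; exact: WG.
by move=> Gg; split; apply: cG => //; exact: perms_invf.
Qed.

Lemma supergroup_addressing : addressing G addr.
Proof.
split.
- apply: (@sub_finite_set _ _ (inl @` [set: 'I_s])); last exact/finite_image/finite_finset.
  by move=> p /addr_inl[t ->]; exists t.
- by move=> [i k]; exists (pt (x0 i) k).
- move=> g p Gg; have [cg cg'] := supergroup_commensurates Gg.
  move=> /(commensurates_none (invf_bij (perms_bij Gg)) cg').
  by rewrite invfV//; exact: perms_bij Gg.
- move=> g p q Gg; have [cg cg'] := supergroup_commensurates Gg.
  exact: (commensurates_addr (perms_bij Gg) cg cg').
- move=> g p q Gg; have [cg cg'] := supergroup_commensurates Gg.
  exact: (commensurates_idx (perms_bij Gg) cg cg').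
- move=> i b bb; exists (permE i b); split.
  + exact/WG/permE_block.
  + by move=> p k /addr_pt[x ->]; rewrite permE_in.
  + by move=> p; exact: permE_out.
Qed.

(** The components of G are finite index supergroups of the [M i], whence the
    first hypothesis; in the induction it is the closure of H_n under finite
    index supergroups. *)
Lemma supergroup_HpredS n :
  (forall X (H H' : permGroup X), perms H `<=` perms H' ->
     fin_index (perms H') (perms H) -> Hpred n H -> Hpred n H') ->
  (forall i, Hpred n (M i)) -> Hpred n.+1 G.
Proof.
move=> Hsup HM; apply: (HpredS_intro _ supergroup_addressing).
  apply: (pclosed_fin_index WG WGfin); apply: pclosed_blockGroup => i.
  exact: Hpred_pclosed (HM i).
move=> [i k]; have [LL Lfin] := finite_index_local (fiber addr (i, k)) WG WGfin.
apply: Hsup LL Lfin _; exact: Hpred_iso (block_local i k) (HM i).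
Qed.

End block_supergroups.

(** * Normalisers *)

Program Definition normaliser (X : Type) (H : permGroup X) : permGroup X :=
  @PermGroup X [set p | bijective p /\ forall h, perms H h ->
    perms H (p \o h \o invf p) /\ perms H (invf p \o h \o p)] _ _ _ _.
Next Obligation. by move=> X H p []. Qed.
Next Obligation.
move=> X H; have idE : invf (@id X) = id by apply: invf_eq.
by split; [exists id | move=> h Hh; rewrite idE].
Qed.
Next Obligation.
move=> X H p q [pb pH] [qb qH]; split; first exact: bij_comp.
move=> h Hh; rewrite invf_comp//; split.
  exact: (pH _ (qH _ Hh).1).1.
exact: (qH _ (pH _ Hh).2).2.
Qed.
Next Obligation.
move=> X H p q [pb pH] pq qp; have pE := invf_eq pq qp.
have qE := invf_eq qp pq.
split; first by exists p.
by move=> h /pH; rewrite pE qE => -[].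
Qed.

(** Two-step index: colour [p] by its class modulo Q, then compare it with a fixed
    representative of that class. *)
Lemma fin_index_trans X (P H : permGroup X) (Q : set (X -> X)) :
  fin_index (perms P) Q -> fin_index (perms P `&` Q) (perms H) ->
  fin_index (perms P) (perms H).
Proof.
move=> [C1 [c1 c1P]] [C2 [c2 c2P]].
have /choice[rep repP] : forall c, exists h,
    (exists p, perms P p /\ c1 p = c) -> perms P h /\ c1 h = c.
  move=> c; have [[p pP]|np] := pselect (exists p, perms P p /\ c1 p = c).
    by exists p.
  by exists id.
exists (C1 * C2)%type, (fun p => (c1 p, c2 (invf (rep (c1 p)) \o p))) => p q Pp Pq [c1pq].
rewrite -c1pq => c2pq.
have [|Pr rE] := repP (c1 p); first by exists p.
set r := rep (c1 p) in Pr rE c2pq.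
have PQ u : perms P u -> c1 u = c1 p -> (perms P `&` Q) (invf r \o u).
  move=> Pu cu; split; last by apply: c1P => //; rewrite rE.
  by apply: perms_comp => //; exact: perms_invf.
have := c2P _ _ (PQ p Pp erefl) (PQ q Pq (esym c1pq)) c2pq.
rewrite (@invf_eq _ _ (invf p \o r)).
- by congr (perms H); apply/funext => x /=; rewrite (permKd Pr).
- by move=> x /=; rewrite (permKd Pr) (permK Pp).
- by move=> x /=; rewrite (permKd Pp) (permK Pr).
Qed.

Section kernel.
Variables (s r : nat) (T : 'I_r -> Type) (M : forall i, permGroup (T i)).
Variable x0 : forall i, T i.

Notation D := (blockDom s T).
Notation W := (perms (blockGroup s M)).

Definition block_kernel : set (D -> D) :=
  [set p | (forall x, addr (p x) = addr x) /\ forall t, p (inl t) = inl t].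

Lemma block_kernel_act p : block_kernel p ->
  exists al, p = act al (fun _ => id).
Proof.
move=> [pa pt_]; have alP i : exists al : nat -> T i -> T i,
    forall x k, p (pt x k) = pt (al k x) k.
  have /choice[al alP] : forall xk : T i * nat, exists y : T i, p (pt xk.1 xk.2) = pt y xk.2.
    by move=> [x k]; apply/addr_pt; rewrite pa.
  by exists (fun k x => al (x, k)) => x k; rewrite (alP (x, k)).
exists (fun i => projT1 (cid (alP i))); apply/funext => -[t|[i [x k]]] /=.
  exact: pt_.
by case: cid => al alE; exact: alE.
Qed.

Variables P H : permGroup D.
Hypotheses (WP : W `<=` perms P) (WH : W `<=` perms H).
Hypothesis P_none : forall p x, perms P p -> addr x = None -> addr (p x) = None.
Hypothesis P_addr : forall p x y, perms P p -> addr x = addr y -> addr (p x) = addr (p y).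
Hypothesis P_idx : forall p x y, perms P p ->
  omap fst (addr x) = omap fst (addr y) -> omap fst (addr (p x)) = omap fst (addr (p y)).

Let fixing : set (D -> D) :=
  [set p | (forall x, omap fst (addr (p x)) = omap fst (addr x)) /\
           forall t, p (inl t) = inl t].

Let fin_index_fixing : fin_index (perms P) fixing.
Proof.
exists ({ffun 'I_s -> 'I_s} * {ffun 'I_r -> 'I_r})%type.
exists (fun p => (finfun (fun t => if p (inl t) is inl u then u else t),
  finfun (fun i => odflt i (omap fst (addr (p (pt (x0 i) 0))))))).
move=> p q Pp Pq [/ffunP pq1 /ffunP pq2].
have p_inl t : p (inl t) = q (inl t).
  have := P_none Pp (erefl : addr (inl t) = None).
  have := P_none Pq (erefl : addr (inl t) = None).
  have := pq1 t; rewrite !ffunE.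
  by case: (p _) => [u|[i []]//]; case: (q _) => [v|[j []]//] ->.
split=> [x|t]; last by rewrite /= -p_inl (permK Pp).
case: (blockP x) => [[t ->]|[i [y [k ->]]]]; first by rewrite /= -p_inl (permK Pp).
set x1 := pt y k.
have pNone z : perms P z -> exists j, omap fst (addr (z (pt (x0 i) 0))) = Some j.
  move=> Pz; case E : (addr _) => [j|]; first by exists j.1.
  by have := P_none (perms_invf Pz) E; rewrite (permK Pz).
have [j pj] := pNone p Pp; have [j' qj] := pNone q Pq.
have := pq2 i; rewrite !ffunE pj qj /= => jj'.
rewrite -jj' -pj in qj.
have x1E : omap fst (addr x1) = omap fst (addr (@pt s r T i (x0 i) 0)) by [].
have := P_idx Pq x1E; rewrite qj => /(P_idx (perms_invf Pp)).
by rewrite (permK Pp).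
Qed.

(** A group that respects points, fibres and factors permutes the finitely many
    points and factors; beyond this, since W induces all permutations of the
    fibres of each factor, only the elements that preserve every fibre
    count. *)
Lemma fin_index_kernel : fin_index (perms P `&` block_kernel) (perms H) ->
  fin_index (perms P) (perms H).
Proof.
move=> [C [col colP]]; apply: (fin_index_trans fin_index_fixing).
have corr p : exists w, (perms P `&` fixing) p -> W w /\ (perms P `&` block_kernel) (p \o w).
  have [[Pp [pi p_inl]]|np] := pselect ((perms P `&` fixing) p); last by exists id.
  have bP i : exists b : nat -> nat, forall x k, addr (p (@pt s r T i x k)) = Some (i, b k).
    have /choice[b bP] : forall k, exists l, addr (p (@pt s r T i (x0 i) k)) = Some (i, l).
      move=> k; have := pi (pt (x0 i) k); case: (addr _) => [[j l] [->]|//].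
      by exists l.
    by exists b => x k; rewrite -bP; apply: P_addr.
  pose b i := projT1 (cid (bP i)).
  have bE i x k : addr (p (@pt s r T i x k)) = Some (i, b i k).
    by rewrite /b; case: cid => b' /= ->.
  have bb i : bijective (b i).
    apply: inj_surj_bij => [k l kl|l].
      have := bE i (x0 i) k; rewrite kl -(bE i (x0 i) l).
      by move=> /(P_addr (perms_invf Pp)); rewrite !(permK Pp) => -[].
    have := pi (invf p (pt (x0 i) l)); rewrite (permKd Pp) => /esym.
    case E : (addr _) => [[j k]|//] /= [ji]; exists k.
    have [y yE] := addr_pt E; have := bE j y k; rewrite -yE (permKd Pp) => -[_ ->].
    by rewrite ji.
  exists (act (fun _ _ => id) (fun i => invf (b i))) => _.
  have Ww : W (act (fun _ _ => id) (fun i => invf (b i))).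
    exists (fun _ _ => id), (fun i => invf (b i)); split=> // i.
      exact: invf_bij.
    by move=> k; exact: perms_id.
  split=> //; split; first by apply: perms_comp => //; exact: WP.
  split=> [[t|[i [x k]]]|t] /=; rewrite ?p_inl//.
  by rewrite bE invfKd.
have /choice[cor corP] := corr.
exists C, (fun p => col (p \o cor p)) => p q Pp Pq pq.
have [Wp Kp] := corP p Pp; have [Wq Kq] := corP q Pq.
have := colP _ _ Kp Kq pq.
set u := cor p in Wp Kp *; set v := cor q in Wq Kq *.
have Gp := Pp.1.
rewrite (@invf_eq _ _ (invf u \o invf p)).
- move=> Huv; rewrite (_ : _ \o _ = u \o (invf u \o invf p \o (q \o v)) \o invf v).
    apply: perms_comp; last by apply: perms_invf; exact: WH.
    by apply: perms_comp => //; exact: WH.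
  by apply/funext => x /=; rewrite (permKd Wp) (permKd Wq).
- by move=> x /=; rewrite (permK Gp) (permK Wp).
- by move=> x /=; rewrite (permKd Wp) (permKd Gp).
Qed.

End kernel.

Section normaliser.
Variables (s r : nat) (T : 'I_r -> Type) (M : forall i, permGroup (T i)).
Variable x0 : forall i, T i.

Notation D := (blockDom s T).
Notation W := (perms (blockGroup s M)).

(** Under this condition the components of G are the [M i] themselves and not
    proper supergroups of them. *)
Definition tight (G : permGroup D) : Prop :=
  forall z g, perms G g -> (forall x, addr x <> Some z -> g x = x) -> W g.

Variable G : permGroup D.
Hypotheses (WG : W `<=` perms G) (WGfin : fin_index (perms G) W) (Gt : tight G).
Hypothesis normM : forall i, fin_index (perms (normaliser (M i))) (perms (M i)).

Let P := normaliser G.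

Let P_commensurates p : perms P p -> commensurates M p /\ commensurates M (invf p).
Proof.
have cP q : perms P q -> commensurates M q.
  move=> Pq; apply: (fin_index_commensurates WGfin); last exact: perms_bij Pq.
  by move=> w /WG /(proj2 Pq)[].
by move=> Pp; split; apply: cP => //; exact: perms_invf.
Qed.

(** Conjugating an element of W supported in one fibre gives an element of G
    supported in the same fibre, which is in W by tightness. *)
Let P_kernel p al : perms P p -> p = act al (fun _ => id) ->
  forall i k, perms (normaliser (M i)) (al i k).
Proof.
have main p' al' : perms P p' -> p' = act al' (fun _ => id) -> forall i k,
   bijective (al' i k) /\
   forall m, perms (M i) m -> perms (M i) (al' i k \o m \o invf (al' i k)).
  move=> {p al} Pp pE i k.
  have pb := perms_bij Pp.
  have ab : bijective (al' i k).
    apply: inj_surj_bij => [x y xy|y].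
      have : p' (pt x k) = p' (pt y k) by rewrite pE /= xy.
      by move=> /(perm_injective Pp) /pt_inj[].
    case: (blockP (invf p' (pt y k))) => [[t]|[j [x [l]]]] /(congr1 p'); rewrite (permKd Pp) pE//=.
    move=> E; have [ij kl] : i = j /\ k = l by have := congr1 addr E => -[].
    case: l / kl E; case: j / ij x => x /pt_inj[-> _].
    by exists x.
  split=> // m Mm.
  have Gh := (proj2 Pp _ (WG (oneE_block s k Mm))).1.
  have hE x : (p' \o oneE k m \o invf p') (pt x k) = pt ((al' i k \o m \o invf (al' i k)) x) k.
    have -> : pt x k = p' (pt (invf (al' i k) x) k) by rewrite pE /= invfKd.
    by rewrite /= (permK Pp) oneE_in pE.
  have Wh : W (p' \o oneE k m \o invf p').
    apply: (Gt (z := (i, k)) Gh) => x xk /=; rewrite oneE_out ?(permKd Pp)// => E; apply: xk.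
    rewrite -(permKd Pp x); have [y ->] := addr_pt E.
    by rewrite pE.
  have [m' Mm' [l m'E]] := block_pt i k Wh.
  rewrite (_ : _ \o _ = m')//; apply/funext => x.
  by have := m'E x; rewrite hE => /pt_inj[].
move=> Pp pE i k; have [ab aM] := main _ _ Pp pE i k.
split=> // h Mh; split; first exact: aM.
have p'E : invf p = act (fun i k => invf (al i k)) (fun _ => id).
  have bb j l : bijective (al j l) by have [] := main _ _ Pp pE j l.
  rewrite pE; apply: invf_eq; apply: act_can => // j l.
    exact: invfK.
  exact: invfKd.
have [_ /(_ h Mh)] := main _ _ (perms_invf Pp) p'E i k.
by rewrite invfV.
Qed.

(** An element of the kernel is determined modulo W by its actions on the fibres
    number 0: by comparison with swaps, its actions on any two fibres of a factor
    differ by an element of [M i]. *)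
Lemma normaliser_fin_index : fin_index (perms P) (perms G).
Proof.
apply: (@fin_index_kernel _ _ _ M x0) => //.
- move=> w Ww; split; first exact: perms_bij Ww.
  move=> h Gh; have Gw := WG Ww; have Gw' := perms_invf Gw.
  by split; do ! apply: perms_comp => //.
- move=> p x Pp; have [cp cp'] := P_commensurates Pp; have pb := perms_bij Pp.
  by move=> /(commensurates_none (invf_bij pb) cp'); rewrite invfV.
- move=> p x y Pp; have [cp cp'] := P_commensurates Pp.
  exact: (commensurates_addr (perms_bij Pp) cp cp').
- move=> p x y Pp; have [cp cp'] := P_commensurates Pp.
  exact: (commensurates_idx (perms_bij Pp) cp cp').
have Ki (p : D -> D) : exists al : forall i, nat -> T i -> T i,
    block_kernel p -> p = act al (fun _ => id).
  have [/block_kernel_act[al ->]|nK] := pselect (block_kernel p); first by exists al.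
  by exists (fun _ _ => id).
have [al alP] := choice Ki.
pose C i := projT1 (cid (normM i)).
pose col i : (T i -> T i) -> C i := projT1 (cid (projT2 (cid (normM i)))).
have colP i p q : perms (normaliser (M i)) p -> perms (normaliser (M i)) q ->
    col i p = col i q -> perms (M i) (invf p \o q).
  exact: (projT2 (cid (projT2 (cid (normM i))))).
exists {dffun forall i, C i}, (fun p => [ffun i => col i (al p i 0)]).
move=> p q [Pp Kp] [Pq Kq] /ffunP pq.
have pE := alP p Kp; have qE := alP q Kq.
have pN := P_kernel Pp pE; have qN := P_kernel Pq qE.
pose a i k := invf (al p i k) \o al q i k.
have uE : invf p \o q = act a (fun _ => id).
  apply/funext => x; apply: (perm_injective Pp); rewrite /= (permKd Pp) [in LHS]qE [in RHS]pE.
  case: x => [t|[i [x k]]] //=.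
  by rewrite /a /= invfKd//; exact: perms_bij (pN i k).
set u := invf p \o q in uE *.
have Pu : perms P u by apply: perms_comp => //; exact: perms_invf.
have aN := P_kernel Pu uE.
have ab i k : bijective (a i k) by apply: perms_bij (aN i k).
have Ma0 i : perms (M i) (a i 0).
  by apply: colP => //; have := pq i; rewrite !ffunE.
suff Ma i j : perms (M i) (a i j).
  by apply: WG; exists a, (fun _ => id); split=> // i; exists id.
have fin n : finite_set (~` [set l | perms (M i) (a i l \o invf (a i n))]).
  apply: contrapT => bad.
  (* w k is a commutator of u and a swap, so it is in G; on the fibre l the
     quotient of w k and w l acts by a i l \o invf (a i n) *)
  pose w k := swapE i n k \o u \o swapE i n k \o invf u.
  have sK k x : swapE i n k (swapE i n k x) = x by apply: swapEK.
  have wK k : cancel (w k) (u \o swapE i n k \o invf u \o swapE i n k).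
    by move=> x; rewrite /w /= sK (permK Pu) sK (permKd Pu).
  have wK' k : cancel (u \o swapE i n k \o invf u \o swapE i n k) (w k).
    by move=> x; rewrite /w /= (permK Pu) sK (permKd Pu) sK.
  have Gw k : perms G (w k).
    have Gs : perms G (swapE i n k) by apply: WG; exact: swapE_block.
    have Gus : perms G (u \o swapE i n k \o invf u) by have [] := proj2 Pu _ Gs.
    exact: (perms_comp Gs Gus).
  have [C' [c cP]] := WGfin.
  have [k [l [[_ /= kn] [Ml /= ln] kl ckl]]] :=
    infinite_pigeonhole (fun k => c (invf (w k))) (infinite_setD bad (finite_set1 n)).
  have Wkl := cP _ _ (perms_invf (Gw k)) (perms_invf (Gw l)) ckl.
  have [m Mm [l' mE]] := block_pt i l Wkl.
  apply: Ml; rewrite /= (_ : _ \o _ = m)//; apply/funext => x.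
  have := mE x; rewrite /= (invfV (perms_bij (Gw k))) (invf_eq (@wK l) (@wK' l)).
  have -> : (u \o swapE i n l \o invf u \o swapE i n l) (pt x l) =
      u (pt (invf (a i n) x) l).
    rewrite /comp; congr u.
    have -> : swapE i n l (pt x l) = pt x n :> D by rewrite /swapE permE_in swapnR.
    have -> : pt x n = u (pt (invf (a i n) x) n) :> D by rewrite uE /= invfKd.
    by rewrite (permK Pu) /swapE permE_in swapnL.
  have uPt y : u (pt y l) = pt (a i l y) l by rewrite uE.
  have sPt (y : T i) : swapE i n k (pt y l) = pt y l :> D.
    by apply: swapE_out => -[lk]; [exact: ln | exact: (kl (esym lk))].
  by rewrite /w /comp (permK Pu) sPt uPt sPt => /pt_inj[].
have [n [/= Mn0 Mnj]] := two_cofinite (fin 0) (fin j).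
rewrite (_ : a i j = invf (a i n \o invf (a i j)) \o (a i n \o invf (a i 0)) \o a i 0).
  by do 2! apply: perms_comp => //; exact: perms_invf.
apply/funext => x; apply: (perm_injective Mnj).
have := permKd Mnj; rewrite /cancel/= => ->.
by rewrite !invfK.
Qed.

End normaliser.

(** * Determining sets and links *)

(** The component of an address [z] is used through the subgroup of G fixing
    everything outside of the Delta-class of [z], so that all permutations live on
    the whole domain. *)
Section structure_theory.
Variables (X : Type) (G : permGroup X) (r : nat) (a : X -> option ('I_r * nat)).
Hypotheses (aG : addressing G a) (cG : pclosed G).
Hypothesis normG : forall z, fin_index
  (perms (normaliser (localGroup G (fiber a z)))) (perms (localGroup G (fiber a z))).

Notation fixing z := (fixOutside G (fiber a z)).

Definition moves (g : X -> X) (z z' : 'I_r * nat) : Prop :=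
  forall x, a x = Some z -> a (g x) = Some z'.

Definition component_on (z : 'I_r * nat) (g : X -> X) : Prop :=
  exists2 m, perms (fixing z) m & forall x, a x = Some z -> g x = m x.

Lemma fixing_sub z m : perms (fixing z) m -> perms G m.
Proof. by case. Qed.

Lemma moves1 g z z' x : perms G g -> a x = Some z -> a (g x) = Some z' -> moves g z z'.
Proof. by move=> Gg xz gx y yz; rewrite -gx; apply: (ad_eq aG Gg); rewrite yz. Qed.

Lemma moves_comp g h z z' z'' : moves g z' z'' -> moves h z z' -> moves (g \o h) z z''.
Proof. by move=> gm hm x /hm /gm. Qed.

Lemma moves_inv g z z' : perms G g -> moves g z z' -> moves (invf g) z' z.
Proof.
move=> Gg gz; have [x xz] := ad_surj aG z.
apply: (moves1 (perms_invf Gg) (gz x xz)).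
by rewrite (permK Gg).
Qed.

Lemma moves_fun g z z' z'' : moves g z z' -> moves g z z'' -> z' = z''.
Proof.
move=> g1 g2; have [x xz] := ad_surj aG z.
by have := g1 x xz; rewrite (g2 x xz) => -[].
Qed.

Lemma moves_inj g z z' z'' : perms G g -> moves g z z'' -> moves g z' z'' -> z = z'.
Proof. by move=> Gg /(moves_inv Gg) g1 /(moves_inv Gg) g2; exact: moves_fun g1 g2. Qed.

Lemma fixing_moves z m z' : perms (fixing z) m -> moves m z' z'.
Proof.
move=> [Gm mz] x xz'; have [zz|zz] := pselect (z = z').
  have mzz := @supp_stable _ m (fiber a z) (perm_injective Gm) mz x.
  by rewrite -zz; apply: mzz; rewrite /fiber /= xz' zz.
by rewrite mz// /fiber /= xz' => -[/esym].
Qed.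

Lemma fixing_conj z z' h m : perms G h -> moves h z z' -> perms (fixing z') m ->
  perms (fixing z) (invf h \o m \o h).
Proof.
move=> Gh hz [Gm mz]; split.
  exact: (perms_comp (perms_comp (perms_invf Gh) Gm) Gh).
move=> x xz /=; rewrite mz ?(permK Gh)// => hxz; apply: xz.
by have := moves_inv Gh hz hxz; rewrite (permK Gh).
Qed.

Lemma component_moves z g : component_on z g -> moves g z z.
Proof. by move=> [m mz gm] x xz; rewrite gm//; exact: fixing_moves mz _ xz. Qed.

Lemma component_id z : component_on z id.
Proof. by exists id => //; exact: (perms_id (fixing z)). Qed.

Lemma component_comp z g h : component_on z g -> component_on z h ->
  component_on z (g \o h).
Proof.
move=> [m mz gm] [n nz hn]; exists (m \o n); first exact: (perms_comp mz nz).
by move=> x xz /=; rewrite hn// gm//; exact: fixing_moves nz _ xz.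
Qed.

Lemma component_inv z g : perms G g -> component_on z g -> component_on z (invf g).
Proof.
move=> Gg [m mz gm]; exists (invf m); first exact: (perms_invf mz).
move=> x xz; apply: (perm_injective Gg); rewrite (permKd Gg) gm ?(permKd mz)//.
exact: fixing_moves (perms_invf mz) _ xz.
Qed.

Lemma component_conj z z' h g : perms G h -> moves h z z' ->
  component_on z' g -> component_on z (invf h \o g \o h).
Proof.
move=> Gh hz [m mz gm]; exists (invf h \o m \o h); first exact: fixing_conj mz.
by move=> x xz /=; rewrite gm//; exact: hz.
Qed.

(** An element that preserves a class normalises its component, which has finite
    index in its normaliser. *)
Lemma component_color z : exists (C : finType) (col : (X -> X) -> C), forall g h,
  perms G g -> perms G h -> moves g z z -> moves h z z -> col g = col h ->
  component_on z (invf g \o h).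
Proof.
set L := localGroup G (fiber a z).
have [C [col colP]] := normG z.
have /choice[res resP] : forall g : X -> X, exists f : fiber a z -> fiber a z,
    perms G g -> moves g z z -> bijective f /\ forall y, val (f y) = g (val y).
  move=> g; have [[Gg gz]|ng] := pselect (perms G g /\ moves g z z); last first.
    by exists id => Gg gz; case: ng.
  have [||f fP] := @restr_ex _ g (fiber a z) (perms_bij Gg); last by exists f.
    exact: gz.
  exact: moves_inv gz.
have resN g : perms G g -> moves g z z -> perms (normaliser L) (res g).
  move=> Gg gz; have [fb fg] := resP g Gg gz; split=> // h.
  have fg' y : val (invf (res g) y) = invf g (val y).
    by apply: (perm_injective Gg); rewrite -fg invfKd// (permKd Gg).
  move=> [hb [m mz hm]]; split; split.
  - exact: (bij_comp (bij_comp fb hb) (invf_bij fb)).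
  - exists (g \o m \o invf g); last by move=> y /=; rewrite fg hm fg'.
    have := fixing_conj (perms_invf Gg) (moves_inv Gg gz) mz.
    by rewrite (invfV (perms_bij Gg)).
  - exact: (bij_comp (bij_comp (invf_bij fb) hb) fb).
  - exists (invf g \o m \o g); last by move=> y /=; rewrite fg' hm fg.
    exact: fixing_conj gz mz.
exists C, (col \o res) => g h Gg Gh gz hz /(colP _ _ (resN g Gg gz) (resN h Gh hz)).
have [gb gE] := resP g Gg gz; have [hb hE] := resP h Gh hz.
move=> [_ [m mz mE]]; exists m => // x xz.
have := mE (insub_set (xz : fiber a z x)) => /= <-.
by apply: (perm_injective Gg); rewrite /= (permKd Gg) -gE (invfKd gb) hE.
Qed.

Lemma components_color (F : seq ('I_r * nat)) :
  exists (C : finType) (col : (X -> X) -> C), forall g h,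
  perms G g -> perms G h -> (forall z, z \in F -> moves g z z) ->
  (forall z, z \in F -> moves h z z) -> col g = col h ->
  forall z, z \in F -> component_on z (invf g \o h).
Proof.
elim: F => [|z F [C [col colP]]]; first by exists unit, (fun=> tt).
have [C' [col' colP']] := component_color z.
exists (C * C')%type, (fun g => (col g, col' g)) => g h Gg Gh gF hF [cgh cgh'] z'.
rewrite inE => /predU1P[->|z'F].
  by apply: colP' => //; [apply: gF|apply: hF]; rewrite inE eqxx.
by apply: colP => // z'' zF; [apply: gF|apply: hF]; rewrite inE zF orbT.
Qed.

(** Finitely many elements of components can be prescribed independently. *)
Lemma assemble (F : seq ('I_r * nat)) (n : 'I_r * nat -> X -> X) :
  (forall z, z \in F -> perms (fixing z) (n z)) ->
  exists h, [/\ perms G h, forall z x, z \in F -> a x = Some z -> h x = n z x &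
    forall x, (forall z, z \in F -> a x <> Some z) -> h x = x].
Proof.
elim: F => [_|z F IHF nF]; first by exists id; split=> //; exact: perms_id.
have [|h [Gh hn hF]] := IHF; first by move=> z' z'F; apply: nF; rewrite inE z'F orbT.
have [zF|zF] := boolP (z \in F).
  exists h; split=> // [z' x|x xF].
    by rewrite inE => /predU1P[->|]; exact: hn.
  by apply: hF => z' z'F; apply: xF; rewrite inE z'F orbT.
have nz : perms (fixing z) (n z) by apply: nF; rewrite inE eqxx.
exists (h \o n z); split.
- by apply: perms_comp => //; exact: fixing_sub nz.
- move=> z' x; rewrite inE => /predU1P[->|z'F] xz /=.
    apply: hF => w wF; rewrite (fixing_moves nz xz) => -[zw].
    by move: zF; rewrite zw wF.
  rewrite nz.2; first exact: hn.
  by rewrite /fiber /= xz => -[zz']; move: zF; rewrite -zz' z'F.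
- move=> x xF /=; rewrite nz.2; last by apply: xF; rewrite inE eqxx.
  by apply: hF => z' z'F; apply: xF; rewrite inE z'F orbT.
Qed.

Lemma finite_addresses (A : set X) : finite_set A ->
  exists F : seq ('I_r * nat), forall z, z \in F <-> exists2 x, A x & a x = Some z.
Proof.
move=> /(finite_image a) /finite_seqP[s sE]; exists (pmap id s) => z.
rewrite mem_pmap map_id; have -> : (Some z \in s) = (Some z \in [set` s]) :> Prop.
  by rewrite inE.
by rewrite -sE inE; split=> -[x]; exists x.
Qed.

(** For each of the finitely many nontrivial cosets of the component of [z],
    represented by the action of some [g0], the permutation that is [g0] on the
    class and the identity elsewhere is not in G.  As G is closed, a finite set
    witnesses this; F collects the classes that these witnesses meet. *)
Lemma determining_set z : exists F : seq ('I_r * nat), z \notin F /\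
  forall g, perms G g -> (forall x, a x = None -> g x = x) -> moves g z z ->
  (forall z', z' \in F -> component_on z' g) -> component_on z g.
Proof.
have [C [col colP]] := component_color z.
have : forall c : C, exists A : set X, finite_set A /\ forall g, perms G g ->
    moves g z z -> col g = c -> ~ component_on z g ->
    ~ exists h, [/\ perms G h, forall x, a x = Some z -> h x = g x &
        forall x, A x -> a x <> Some z -> h x = x].
  move=> c; have [[g0 [Gg0 g0z g0c g0M]]|ng] := pselect (exists g,
    [/\ perms G g, moves g z z, col g = c & ~ component_on z g]); last first.
    exists set0; split; first exact: finite_set0.
    by move=> g Gg gz gc gM; case: ng; exists g.
  pose rot g x := if a x == Some z then g x else x.
  have rotE g x : a x = Some z -> rot g x = g x by move=> xz; rewrite /rot xz eqxx.
  have rotD g x : a x <> Some z -> rot g x = x by move=> /eqP/negPf xz; rewrite /rot xz.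
  have rotK g g' : moves g z z -> cancel g g' -> cancel (rot g) (rot g').
    move=> gz gg' x; have [xz|xz] := pselect (a x = Some z); last by rewrite !rotD.
    by rewrite (rotE g)// rotE ?gg'//; exact: gz.
  have rotb : bijective (rot g0).
    exists (rot (invf g0)); apply: rotK => //.
    - exact: permK Gg0.
    - exact: moves_inv g0z.
    - exact: permKd Gg0.
  have : ~ perms G (rot g0).
    move=> Gr; apply: g0M; exists (rot g0); last by move=> x xz; rewrite rotE.
    by split=> // x xz; rewrite rotD.
  move=> /(contra_not (cG rotb)) /existsNP[A /not_implyP[finA nA]].
  exists A; split=> // g Gg gz gc gM [h [Gh hz hA]]; apply: nA.
  have [m mz mE] := colP _ _ Gg0 Gg g0z gz (etrans g0c (esym gc)).
  have Gm := fixing_sub mz.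
  exists (h \o invf m); first by apply: perms_comp => //; exact: perms_invf.
  move=> x Ax; have [xz|xz] := pselect (a x = Some z); last first.
    by rewrite rotD//= (perms_invf mz).2// hA.
  have mx := fixing_moves (perms_invf mz) xz.
  rewrite rotE//= hz//; apply: (perm_injective (perms_invf Gg0)).
  by have := mE _ mx; rewrite /= (permKd Gm) (permK Gg0).
move=> /choice[A AP].
have fA : finite_set (\bigcup_(c in [set: C]) A c).
  by apply: bigcup_finite => [|c _]; [exact: finite_finset | exact: (AP c).1].
have [F FP] := finite_addresses fA.
exists [seq z' <- F | z' != z]; split; first by rewrite mem_filter eqxx.
move=> g Gg gK gz gF; apply: contrapT => gM.
apply: ((AP (col g)).2 g Gg gz erefl gM).
have /choice[m mP] : forall z', exists m, z' \in [seq z' <- F | z' != z] ->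
    perms (fixing z') m /\ forall x, a x = Some z' -> g x = m x.
  move=> z'; have [/gF[m mz mE]|_] := boolP (z' \in [seq z' <- F | z' != z]).
    by exists m.
  by exists id.
have [|h [Gh hF hid]] := @assemble [seq z' <- F | z' != z] (fun z' => invf (m z')).
  by move=> z' /mP[mz' _]; exact: (perms_invf mz').
exists (g \o h); split; first exact: perms_comp.
  by move=> x xz /=; rewrite hid// => z'; rewrite mem_filter xz => /andP[/eqP z'z _] [/esym].
move=> x Ax xz /=; case E : (a x) => [z'|]; last by rewrite hid ?gK// E.
have z'F : z' \in [seq z' <- F | z' != z].
  rewrite mem_filter; apply/andP; split; last first.
    by apply/FP; exists x => //; exists (col g).
  by apply/eqP => z'z; apply: xz; rewrite E z'z.
have [mz' mE] := mP _ z'F.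
by rewrite (hF _ _ z'F E) mE ?(permKd mz')//; exact: fixing_moves (perms_invf mz') _ E.
Qed.

(** The local group of the i-th Nabla-class, which induces Sym(omega) on the
    Delta-classes in it. *)
Notation L i := (fixOutside G [set x | omap fst (a x) = Some i]).

Lemma L_sym i b : bijective b -> exists g, perms (L i) g /\
  forall k, moves g (i, k) (i, b k).
Proof.
move=> bb; have [g [Gg gb gi]] := ad_sym aG i bb.
by exists g; split; [split | move=> k x; exact: gb].
Qed.

Lemma L_none i g x : perms (L i) g -> a x = None -> g x = x.
Proof. by move=> [_ gi] xN; apply: gi => /=; rewrite xN. Qed.

Lemma L_other i g z : perms (L i) g -> z.1 <> i -> component_on z g.
Proof.
move=> [_ gi] zi; exists id; first exact: (perms_id (fixing z)).
by move=> x xz; apply: gi; rewrite /= xz => -[].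
Qed.

Lemma L_moves_ex i g k : perms (L i) g -> exists l, moves g (i, k) (i, l).
Proof.
move=> [Gg gi]; have [x xk] := ad_surj aG (i, k).
have : omap fst (a (g x)) = Some i.
  apply: (@supp_stable _ g [set x | omap fst (a x) = Some i] (perm_injective Gg) gi).
  by rewrite /= xk.
case E : (a (g x)) => [[j l]|//] /= [ji]; exists l.
by apply: (moves1 Gg xk); rewrite E ji.
Qed.

Lemma L_sub i g : perms (L i) g -> perms G g.
Proof. by case. Qed.

(** A determining set for the class (i, 0) determines all other classes (i, k) as
    well: an element of [L i] exchanges the two and preserves the set. *)
Lemma determining_set_uniform i : exists F : seq ('I_r * nat), forall g, perms G g ->
  (forall x, a x = None -> g x = x) -> forall k, moves g (i, k) (i, k) ->
  (forall z, z \in F -> component_on z g) -> component_on (i, k) g.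
Proof.
have [F [F0 FP]] := determining_set (i, 0); exists F => g Gg gK k gk gF.
have [/gF//|kF] := boolP ((i, k) \in F).
have [s [Ls sP]] := L_sym i (swapn_bij 0 k).
have Gs := L_sub Ls.
have s0 : moves s (i, 0) (i, k) by have := sP 0; rewrite swapnL.
have : component_on (i, 0) (invf s \o g \o s).
  apply: FP.
  - exact: (perms_comp (perms_comp (perms_invf Gs) Gg) Gs).
  - move=> x xN /=; rewrite (L_none Ls xN) gK//.
    by rewrite (L_none (perms_invf Ls)).
  - apply: (moves_comp _ s0); apply: (moves_comp _ gk).
    exact: moves_inv Gs s0.
  - move=> [j l] zF; apply: (component_conj Gs) (gF _ zF).
    have [ji|ji] := eqVneq j i; last first.
      by apply: component_moves; apply: (L_other Ls); exact/eqP.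
    rewrite ji; have := sP l; rewrite swapnD// => lE.
      by move: zF F0; rewrite ji lE => ->.
    by move: zF kF; rewrite ji lE => ->.
move=> /(component_conj (perms_invf Gs) (moves_inv Gs s0)).
rewrite (invfV (perms_bij Gs)); congr component_on.
by apply/funext => x /=; rewrite !(permKd Gs).
Qed.

(** A determining set for all classes of the i-th Nabla-class, as far as elements
    of [L i] are concerned.  Then the classes outside of the i-th Nabla-class
    impose nothing, and a base is a set of numbers. *)
Definition base i (B : seq nat) : Prop := forall g, perms (L i) g ->
  forall k, moves g (i, k) (i, k) ->
  (forall j, j \in B -> component_on (i, j) g) -> component_on (i, k) g.

Lemma base_ex i : exists B, base i B.
Proof.
have [F FP] := determining_set_uniform i.
exists [seq z.2 | z <- F & z.1 == i] => g Lg k gk gB.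
apply: FP => // [|x|[j l] zF]; [exact: L_sub Lg | exact: L_none Lg |].
have [ji|ji] := eqVneq j i; last by apply: (L_other Lg); exact/eqP.
rewrite ji; apply: gB; apply/mapP; exists (j, l) => //.
by rewrite mem_filter /= ji eqxx -ji.
Qed.

Lemma base_move i B b : bijective b -> base i B -> base i (map b B).
Proof.
move=> bb bB g Lg k gk gB; have [s [Ls sP]] := L_sym i bb.
have [b' bK bK'] := bb; have Gs := L_sub Ls.
have sk : moves s (i, b' k) (i, k) by have := sP (b' k); rewrite bK'.
have : component_on (i, b' k) (invf s \o g \o s).
  apply: bB.
  - exact: (perms_comp (perms_comp (perms_invf Ls) Lg) Ls).
  - by apply: (moves_comp _ sk); apply: (moves_comp _ gk); exact: moves_inv Gs sk.
  - by move=> j jB; apply: (component_conj Gs (sP j)); apply: gB; exact: map_f.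
move=> /(component_conj (perms_invf Gs) (moves_inv Gs sk)).
rewrite (invfV (perms_bij Gs)); congr component_on.
by apply/funext => x /=; rewrite !(permKd Gs).
Qed.

Lemma seq_bound (B : seq nat) : exists N, forall j, j \in B -> j < N.
Proof.
elim: B => [|k B [N NP]]; first by exists 0.
exists (maxn k.+1 N) => j; rewrite inE leq_max => /predU1P[->|/NP ->].
  by rewrite ltnSn.
by rewrite orbT.
Qed.

(** The images of a base under permutations of the classes are again bases; move it
    beyond all numbers that occur in D. *)
Lemma base_avoid i (D : seq nat) : exists2 B, base i B & forall j, j \in B -> j \notin D.
Proof.
have [B bB] := base_ex i; have [N NP] := seq_bound (B ++ D).
(* exchange the intervals [0, N[ and [N, 2N[ *)
pose b k := if k < N then k + N else if k < N + N then k - N else k.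
have bK : involutive b.
  move=> k; rewrite /b; case: (ltnP k N) => kN.
    by rewrite ltnNge leq_addl /= ltn_add2r kN addnK.
  case: (ltnP k (N + N)) => kNN; last by rewrite ltnNge kN /= ltnNge kNN.
  by rewrite ltn_subLR// kNN subnK.
exists (map b B); first exact/base_move/bB/inv_bij.
move=> _ /mapP[j jB ->]; apply/negP => bD.
have jN : j < N by apply: NP; rewrite mem_cat jB.
have : b j < N by apply: NP; rewrite mem_cat bD orbT.
by rewrite /b jN ltnNge leq_addl.
Qed.

(** For each l the group [L i] contains an element g_l that swaps the classes k
    and l.  Two of them, for l and m outside of B, act on B in the same way up to
    components, so g_l g_m^-1 moves m to l and acts on B through components;
    conjugate it to move k to k'. *)
Lemma single_move i (B : seq nat) k k' : k \notin B -> k' \notin B ->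
  exists g, [/\ perms (L i) g, moves g (i, k) (i, k') &
    forall j, j \in B -> component_on (i, j) g].
Proof.
move=> kB k'B; have [<-|kk'] := eqVneq k k'.
  exists id; split=> // [|j _]; first exact: (perms_id (L i)).
  exact: component_id.
have /choice[g gP] : forall l, exists g, perms (L i) g /\
    forall n, moves g (i, n) (i, swapn k l n).
  by move=> l; exact/L_sym/swapn_bij.
have [C [col colP]] := components_color [seq (i, j) | j <- B].
have Binf : infinite_set ([set: nat] `\` [set` k :: k' :: B]).
  exact: infinite_setD infinite_nat (finite_seq _).
have [l [m [[_ /= /negP lB] [_ /= /negP mB] lm clm]]] :=
  infinite_pigeonhole (fun l => col (invf (g l))) Binf.
move: lB mB; rewrite !inE !negb_or => /and3P[/eqP lk /eqP lk' lB] /and3P[/eqP mk /eqP mk' mB].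
have gB n j : n \notin B -> j \in B -> moves (invf (g n)) (i, j) (i, j).
  move=> nB jB; have [[Gg _] gn] := gP n; apply: (moves_inv Gg).
  by have := gn j; rewrite swapnD// => E; [move: kB|move: nB]; rewrite -E jB.
have [Ll gl] := gP l; have [Lm gm] := gP m.
have gF n : n \notin B -> forall z, z \in [seq (i, j) | j <- B] -> moves (invf (g n)) z z.
  by move=> nB z /mapP[j jB ->]; exact: gB.
have := colP _ _ (perms_invf (L_sub Ll)) (perms_invf (L_sub Lm)) (gF l lB) (gF m mB) clm.
rewrite (invfV (perms_bij Ll)); set u := _ \o _ => uB.
have Lu : perms (L i) u := perms_comp Ll (perms_invf Lm).
have um : moves u (i, m) (i, l).
  apply: (@moves_comp _ _ _ (i, k)); first by have := gl k; rewrite swapnL.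
  by apply: (moves_inv (L_sub Lm)); have := gm k; rewrite swapnL.
(* s moves m to k and l to k', and fixes the classes in B *)
have [s [Ls sP]] := L_sym i (bij_comp (swapn_bij m k) (swapn_bij l k')).
have Gs := L_sub Ls.
have sm : moves s (i, m) (i, k).
  have := sP m; rewrite /= (@swapnD l k' m); [|exact/nesym|exact: mk'].
  by rewrite swapnL.
have sl : moves s (i, l) (i, k').
  have := sP l; rewrite /= swapnL swapnD//; [exact/nesym|].
  by move/esym; exact/eqP.
have sB j : j \in B -> moves s (i, j) (i, j).
  move=> jB; have neq n : n \notin B -> j <> n by move=> nB E; rewrite -E jB in nB.
  by have := sP j; rewrite /= !swapnD//; exact: neq.
exists (s \o u \o invf s); split.
- exact: (perms_comp (perms_comp Ls Lu) (perms_invf Ls)).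
- by apply: (moves_comp _ (moves_inv Gs sm)); exact: (moves_comp _ um).
- move=> j jB; rewrite -{1}(invfV (perms_bij Gs)).
  apply: (component_conj (perms_invf Gs) (moves_inv Gs (sB j jB))).
  by apply: uB; exact: map_f.
Qed.

(** One class is treated at a time: the classes that already are in place are added
    to the set on which the next element acts through components. *)
Lemma multi_move i (D B : seq nat) b : uniq D -> injective b ->
  (forall k, k \in D -> k \notin B /\ b k \notin B) ->
  exists g, [/\ perms (L i) g, forall j, j \in B -> component_on (i, j) g &
    forall k, k \in D -> moves g (i, k) (i, b k)].
Proof.
move=> + bi; elim: D => [_ _|k D IHD /= /andP[kD uD] DB].
  exists id; split=> //; first exact: (perms_id (L i)).
  by move=> j _; exact: component_id.
have [//||g [Lg gB gD]] := IHD.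
  by move=> l lD; apply: DB; rewrite inE lD orbT.
have [k1 gk] := L_moves_ex k Lg.
have [kB bkB] : k \notin B /\ b k \notin B by apply: DB; rewrite inE eqxx.
have [||h [Lh hk hB]] := @single_move i (B ++ map b D) k1 (b k).
- rewrite mem_cat negb_or; apply/andP; split; apply/negP.
    move=> k1B; have := moves_inj (L_sub Lg) gk (component_moves (gB _ k1B)).
    by move=> -[E]; move: kB; rewrite E k1B.
  move=> /mapP[l lD k1E]; rewrite k1E in gk.
  have := moves_inj (L_sub Lg) gk (gD _ lD).
  by move=> -[E]; move: kD; rewrite E lD.
- by rewrite mem_cat negb_or bkB mem_map.
exists (h \o g); split; first exact: (perms_comp Lh Lg).
  by move=> j jB; apply: component_comp; [apply: hB; rewrite mem_cat jB|exact: gB].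
move=> l; rewrite inE => /predU1P[->|lD]; first exact: (moves_comp _ gk).
apply: (moves_comp _ (gD l lD)); apply: component_moves; apply: hB.
by rewrite mem_cat map_f// orbT.
Qed.

(** The identifications between the Delta-classes of one Nabla-class: those induced
    by elements acting through components on some base that avoids both
    classes. *)
Definition link i k k' g : Prop := [/\ perms (L i) g, moves g (i, k) (i, k') &
  exists B, [/\ base i B, k \notin B, k' \notin B &
    forall j, j \in B -> component_on (i, j) g]].

Lemma link_ex i k k' : exists g, link i k k' g.
Proof.
have [B bB BD] := base_avoid i [:: k; k'].
have kB : k \notin B by apply/negP => /BD; rewrite inE eqxx.
have k'B : k' \notin B by apply/negP => /BD; rewrite !inE eqxx orbT.
have [g [Lg gk gB]] := single_move i kB k'B.
by exists g; split=> //; exists B.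
Qed.

(** Compare both links with one that acts through components on the union of the
    two bases. *)
Lemma link_uniq i k k' g h : link i k k' g -> link i k k' h ->
  component_on (i, k) (invf g \o h).
Proof.
move=> [Lg gk [B [bB kB k'B gB]]] [Lh hk [B' [bB' kB' k'B' hB']]].
have [||u [Lu uk uB]] := @single_move i (B ++ B') k k'.
- by rewrite mem_cat negb_or kB.
- by rewrite mem_cat negb_or k'B.
have key v C : perms (L i) v -> moves v (i, k) (i, k') -> base i C ->
    {subset C <= B ++ B'} -> (forall j, j \in C -> component_on (i, j) v) ->
    component_on (i, k) (invf v \o u).
  move=> Lv vk bC CB vC; apply: bC.
  - exact: (perms_comp (perms_invf Lv) Lu).
  - by apply: (moves_comp _ uk); exact: moves_inv (L_sub Lv) vk.
  - move=> j jC; apply: component_comp; last exact/uB/CB.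
    by apply: component_inv; [exact: L_sub Lv | exact: vC].
have gu := key g B Lg gk bB (mem_subseq (prefix_subseq _ _)) gB.
have hu := key h B' Lh hk bB' (mem_subseq (suffix_subseq _ _)) hB'.
have Ghu : perms G (invf h \o u).
  exact: (perms_comp (perms_invf (L_sub Lh)) (L_sub Lu)).
have := component_comp gu (component_inv Ghu hu).
congr component_on; apply/funext => x.
rewrite (@invf_eq _ (invf h \o u) (invf u \o h)) /=; first by rewrite (permKd Lu).
- by move=> y /=; rewrite (permKd Lh) (permK Lu).
- by move=> y /=; rewrite (permKd Lu) (permK Lh).
Qed.

(** With a common base that avoids all three classes, the composite of links is a
    link; uniqueness reduces the general case to this one. *)
Lemma link_comp i k k' k'' g g' g'' : link i k k' g -> link i k' k'' g' ->
  link i k k'' g'' -> component_on (i, k) (invf g'' \o (g' \o g)).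
Proof.
move=> lg lg' lg''.
have [B bB BD] := base_avoid i [:: k; k'; k''].
have kB : k \notin B by apply/negP => /BD; rewrite inE eqxx.
have k'B : k' \notin B by apply/negP => /BD; rewrite !inE eqxx orbT.
have k''B : k'' \notin B by apply/negP => /BD; rewrite !inE eqxx !orbT.
have [u [Lu uk uB]] := single_move i kB k'B.
have [v [Lv vk vB]] := single_move i k'B k''B.
have lu : link i k k' u by split=> //; exists B.
have lv : link i k' k'' v by split=> //; exists B.
have lvu : link i k k'' (v \o u).
  split; [exact: (perms_comp Lv Lu)|exact: (moves_comp _ uk)|exists B; split=> // j jB].
  by apply: component_comp; [exact: vB|exact: uB].
have := component_comp (component_comp (link_uniq lg'' lvu)
  (component_conj (L_sub Lu) uk (link_uniq lv lg'))) (link_uniq lu lg).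
congr component_on; apply/funext => x /=.
by rewrite (permKd Lu) (permKd Lu) (permKd Lv).
Qed.

End structure_theory.

(** * The structure theorem *)

(** The links [gam i k] from the class (i, 0) to the class (i, k) identify the
    domain of G with the domain of a block group. *)
Section chart.
Variables (X : Type) (G : permGroup X) (r : nat) (a : X -> option ('I_r * nat)).
Hypotheses (aG : addressing G a) (cG : pclosed G).
Hypothesis normG : forall z, fin_index
  (perms (normaliser (localGroup G (fiber a z)))) (perms (localGroup G (fiber a z))).

Notation fixing z := (fixOutside G (fiber a z)).
Notation L i := (fixOutside G [set x | omap fst (a x) = Some i]).

Let T (i : 'I_r) : Type := fiber a (i, 0).
Let M (i : 'I_r) : permGroup (T i) := localGroup G (fiber a (i, 0)).

Variables (gam : 'I_r -> nat -> X -> X) (s : nat) (pnt : 'I_s -> X).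
Hypothesis gamP : forall i k, link G a i 0 k (gam i k).
Hypotheses (pnt_inj : injective pnt) (pntP : forall x, a x = None <-> exists t, pnt t = x).

Let gamL i k : perms (L i) (gam i k). Proof. by have [] := gamP i k. Qed.
Let gamG i k : perms G (gam i k). Proof. exact: L_sub (gamL i k). Qed.
Let gam_moves i k : moves a (gam i k) (i, 0) (i, k).
Proof. by have [] := gamP i k. Qed.

Definition chart (p : blockDom s T) : X :=
  match p with
  | inl t => pnt t
  | inr (existT i xk) => gam i xk.2 (val xk.1)
  end.

Lemma T_addr i (x : T i) : a (val x) = Some (i, 0).
Proof. exact: (set_valP x). Qed.

Lemma chart_addr p : a (chart p) = addr p.
Proof.
case: p => [t|[i [x k]]] /=; first by apply/pntP; exists t.
exact: gam_moves (T_addr x).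
Qed.

Lemma chart_bij : bijective chart.
Proof.
apply: inj_surj_bij => [p q pq|x].
  have := chart_addr p; rewrite pq chart_addr.
  case: p pq => [t|[i [x k]]]; case: q => [u|[j [y l]]] //=.
    by move=> /pnt_inj ->.
  move=> pq /esym[ij kl]; case: j / ij y pq => y; rewrite -kl.
  by move=> /(perm_injective (gamG i k)) /val_inj ->.
case E : (a x) => [[i k]|]; last by have [t tx] := (pntP x).1 E; exists (inl t).
have xk := moves_inv aG (gamG i k) (@gam_moves i k) E.
exists (pt (insub_set (xk : fiber a (i, 0) (invf (gam i k) x)) : T i) k) => /=.
exact: permKd (gamG i k) _.
Qed.

Variable chart' : X -> blockDom s T.
Hypotheses (cK : cancel chart chart') (cK' : cancel chart' chart).

Definition charted : permGroup (blockDom s T) := transport cK' cK G.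

Notation D := (blockDom s T).
Notation W := (perms (blockGroup s M)).

(** Conjugation by [gam i k] carries the component of (i, k) to that of (i, 0). *)
Lemma chart_pull i k n : perms (fixing (i, k)) n ->
  exists2 m, perms (M i) m & forall x, n (chart (pt x k)) = chart (pt (m x) k).
Proof.
move=> nk; have [Gh hY] := fixing_conj aG (gamG i k) (@gam_moves i k) nk.
have [m Mm mE] := localGroup_ex Gh hY; exists m => // x /=.
by rewrite mE /= (permKd (gamG i k)).
Qed.

Lemma charted_tight : tight M charted.
Proof.
move=> [i k] g Gg gz.
have gE p : chart (g p) = (chart \o g \o chart') (chart p) by rewrite /= cK.
have [m Mm mE] : exists2 m, perms (M i) m & forall x,
    (chart \o g \o chart') (chart (pt x k)) = chart (pt (m x) k).
  apply: chart_pull; split; first exact: Gg.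
  move=> x xz /=; rewrite gz ?cK'// -chart_addr cK'; exact: xz.
suff -> : g = oneE k m by exact: oneE_block.
apply/funext => p; have [pz|pz] := pselect (addr p = Some (i, k)).
  have [x ->] := addr_pt pz; rewrite oneE_in; apply: (can_inj cK).
  by rewrite gE mE.
by rewrite oneE_out// gz.
Qed.

(** A permutation that acts on the i-th factor by links and elements of the
    component is approximated on a finite set by an element moving the finitely
    many classes concerned in the same way.  As links compose, the two differ on
    each of these classes by an element of its component. *)
Lemma charted_single i al be : bijective be -> (forall k, perms (M i) (al k)) ->
  forall f : D -> D, bijective f ->
  (forall x k, f (pt x k) = pt (al k x) (be k)) ->
  (forall p, omap fst (addr p) <> Some i -> f p = p) -> perms charted f.
Proof.
move=> beb Mal f fb fin fout; apply: cG.
  by apply: bij_comp; [apply: bij_comp fb; exists chart'|exists chart].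
move=> A finA; have [F FP] := finite_addresses a finA.
pose D := undup [seq z.2 | z <- F & z.1 == i].
have DP x k : A x -> a x = Some (i, k) -> k \in D.
  move=> Ax xk; rewrite mem_undup; apply/mapP; exists (i, k) => //.
  by rewrite mem_filter eqxx; apply/FP; exists x.
have [B bB BD] := base_avoid aG cG normG i (D ++ map be D).
have avoid k : k \in D -> k \notin B /\ be k \notin B.
  move=> kD; split; apply/negP => /BD; rewrite mem_cat ?kD//.
  by rewrite map_f ?orbT.
have [g [Lg gB gD]] := multi_move aG normG i (undup_uniq _) (bij_inj beb) avoid.
have Gg := L_sub Lg.
have glink k : k \in D -> link G a i k (be k) g.
  move=> kD; have [kB bkB] := avoid k kD.
  by split=> //; [exact: gD | exists B].
have corr z : exists n, (exists2 k, k \in D & z = (i, k)) ->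
    perms (fixing z) n /\ forall x, a x = Some z -> chart (f (chart' x)) = g (n x).
  have [[k kD ->]|nD] := pselect (exists2 k, k \in D & z = (i, k)); last by exists id.
  have [m' mz m'E] := link_comp aG cG normG (gamP i k) (glink k kD) (gamP i (be k)).
  have [_ [m mz0 mE]] := Mal k.
  have Gk := gamG i k.
  (* g \o gam i k and gam i (be k) are links from 0 to be k, so they differ by
     some m' in the component of (i, 0); this is the correction that turns g
     into the given permutation on the class (i, k) *)
  exists (gam i k \o (invf m' \o m) \o invf (gam i k)) => _; split.
    have := fixing_conj aG (perms_invf Gk) (moves_inv aG Gk (@gam_moves i k))
      (perms_comp (perms_invf mz) mz0).
    by rewrite (invfV (perms_bij Gk)).
  move=> x xk; have : addr (chart' x) = Some (i, k) by rewrite -chart_addr cK'.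
  move=> /addr_pt[y yE]; have -> : x = chart (pt y k) by rewrite -yE cK'.
  rewrite cK fin /= (permK Gk) mE.
  set w := invf m' _.
  have wE : a w = Some (i, 0).
    exact: (fixing_moves (perms_invf mz) (fixing_moves mz0 (T_addr y))).
  have := m'E w wE; rewrite /= /w (permKd mz) => mw.
  apply: (perm_injective (perms_invf (gamG i (be k)))).
  by rewrite (permK (gamG i (be k))); exact: (esym mw).
have /choice[n nP] := corr.
have [|h [Gh hn hid]] := @assemble _ G _ a [seq (i, k) | k <- D] n.
  by move=> z /mapP[k kD zE]; apply: (nP z _).1; exists k.
exists (g \o h); first exact: perms_comp.
move=> x Ax /=; have [xi|xi] := pselect (omap fst (a x) = Some i).
  have [k xk] : exists k, a x = Some (i, k).
    by move: xi; case: (a x) => [[j k]|//] [->]; exists k.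
  have kD := DP x k Ax xk.
  rewrite (hn (i, k))//; last exact: map_f.
  by apply: (nP (i, k) _).2 => //; exists k.
rewrite hid; last by move=> z /mapP[k _ ->] E; apply: xi; rewrite E.
rewrite Lg.2; last exact: xi.
by rewrite fout ?cK'// -chart_addr cK'.
Qed.

(** An element of W is the product of its restrictions to the finitely many
    factors. *)
Lemma charted_block : W `<=` perms charted.
Proof.
move=> _ [al [be [beb Mal ->]]].
pose f (J : seq 'I_r) := act (s := s) (fun i k => if i \in J then al i k else id)
  (fun i => if i \in J then be i else id).
suff Gf J : perms charted (f J).
  have -> : act al be = f (enum 'I_r); last exact: Gf.
  by apply: act_ext => i k; rewrite mem_enum.
elim: J => [|i J IHJ].
  by rewrite (_ : f _ = id) ?act_id; [exact: perms_id | rewrite /f -act_id].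
have [iJ|iJ] := boolP (i \in J).
  rewrite (_ : f _ = f J)//; apply: act_ext => [j k x|j k].
    by rewrite inE; case: eqP => // ji; have -> : j \in J by rewrite ji.
  by rewrite inE; case: eqP => // ->; rewrite iJ.
pose g := act (s := s) (fun j k => if j == i then al j k else id)
  (fun j => if j == i then be j else id).
have -> : f (i :: J) = g \o f J.
  rewrite /f /g act_comp; apply: act_ext => [j k x|j k] /=; rewrite inE.
    by case: eqP => // ji; have /negPf -> : j \notin J by rewrite ji.
  by case: eqP => // -> /=; rewrite (negPf iJ).
apply: perms_comp IHJ.
have Wg : W g.
  exists (fun j k => if j == i then al j k else id), (fun j => if j == i then be j else id).
  split=> // [j|j k]; case: eqP => // _; first by exists id.
  exact: perms_id.
apply: (@charted_single i (al i) (be i)) => //; first exact: perms_bij Wg.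
  by move=> x k; rewrite /g /= eqxx.
move=> [t|[j [x k]]] //= ji; rewrite /g /= /pt.
by case: eqP => // ji'; case: ji; rewrite ji'.
Qed.

(** By [fin_index_kernel] only the elements that preserve every class matter, and
    they are determined up to components by their actions on the union of the
    determining sets. *)
Lemma charted_fin_index : fin_index (perms charted) W.
Proof.
have toG g : perms charted g -> perms G (chart \o g \o chart') by [].
have gE g p : addr (g p) = a ((chart \o g \o chart') (chart p)).
  by rewrite /= cK chart_addr.
have aE p : addr p = a (chart p) by rewrite chart_addr.
have x0 i : T i.
  by have [x xi] := cid (ad_surj aG (i, 0)); exact: (insub_set (xi : fiber a (i, 0) x)).
apply: (@fin_index_kernel _ _ _ M x0) => //.
- exact: charted_block.
- by move=> p x /toG Gp; rewrite gE aE; exact: ad_none aG _ _ Gp.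
- by move=> p x y /toG Gp; rewrite !gE !aE; exact: ad_eq aG _ _ _ Gp.
- by move=> p x y /toG Gp; rewrite !gE !aE; exact: ad_idx aG _ _ _ Gp.
have /choice[F FP] := determining_set_uniform aG cG normG.
have [C [col colP]] := components_color aG normG (flatten [seq F i | i <- enum 'I_r]).
exists C, (fun p => col (chart \o p \o chart')) => p q [Gp [pa pt_]] [Gq [qa qt]] pq.
have stab g z : (forall x, addr (g x) = addr x) -> moves a (chart \o g \o chart') z z.
  by move=> ga x xz /=; rewrite chart_addr ga -chart_addr cK'.
have := colP _ _ (toG _ Gp) (toG _ Gq) (fun z _ => stab p z pa) (fun z _ => stab q z qa) pq.
set u := invf p \o q.
have Gu : perms charted u := perms_comp (perms_invf Gp) Gq.
have ua x : addr (u x) = addr x by rewrite -pa /u /= (permKd Gp) qa.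
have ut t : u (inl t) = inl t by rewrite /u /= qt -[in LHS](pt_ t) (permK Gp).
have uE : invf (chart \o p \o chart') \o (chart \o q \o chart') = chart \o u \o chart'.
  rewrite (@invf_eq _ _ (chart \o invf p \o chart')).
  - by apply/funext => x; rewrite /= cK.
  - by move=> x; rewrite /= cK (permK Gp) cK'.
  - by move=> x; rewrite /= cK (permKd Gp) cK'.
rewrite uE => uF.
have uM i k : component_on G a (i, k) (chart \o u \o chart').
  apply: (FP i) => //.
  - move=> x xN /=; have : addr (chart' x) = None by rewrite -chart_addr cK'.
    by move=> /addr_inl[t tE]; rewrite tE ut -tE cK'.
  - exact: stab.
  - move=> z zF; apply: uF; apply/flattenP; exists (F i) => //.
    by apply: map_f; rewrite mem_enum.
have [al alE] := @block_kernel_act _ _ _ u (conj ua ut).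
exists al, (fun _ => id); split=> // [i|i k]; first by exists id.
have [n nk nE] := uM i k; have [m Mm mE] := chart_pull nk.
rewrite (_ : al i k = m)//; apply/funext => x.
have xk : a (chart (pt x k)) = Some (i, k) by rewrite chart_addr.
have := nE _ xk; rewrite mE /comp cK alE.
by move=> /(can_inj cK) /pt_inj[].
Qed.

End chart.

Theorem structure_theorem X (G : permGroup X) n :
  (forall Y (H : permGroup Y), Hpred n H -> fin_index (perms (normaliser H)) (perms H)) ->
  Hpred n.+1 G ->
  exists (s r : nat) (T : 'I_r -> Type) (M : forall i, permGroup (T i))
    (G' : permGroup (blockDom s T)),
  [/\ forall i, Hpred n (M i) /\ inhabited (T i),
      isomorphic (DPermGroup G) (DPermGroup G'),
      perms (blockGroup s M) `<=` perms G',
      fin_index (perms G') (perms (blockGroup s M)) &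
      tight M G'].
Proof.
move=> norm /HpredS_elim[cG [r [a [aG aH]]]].
have normG z := norm _ _ (aH z).
have [s [pnt [pnt_inj pntP]]] : exists s (pnt : 'I_s -> X), injective pnt /\
    forall x, a x = None <-> exists t, pnt t = x.
  have [s /card_set_bijP[f [fS fi fs]]] := ad_fin aG.
  have /choice[pnt pE] : forall t : 'I_s, exists x, a x = None /\ f x = val t.
    by move=> t; have [x ax fx] := fs t (ltn_ord t); exists x.
  exists s, pnt; split=> [t u tu|x].
    by apply: val_inj; rewrite /= -(pE t).2 -(pE u).2 tu.
  split=> [ax|[t <-]]; last by have [] := pE t.
  exists (Ordinal (fS x ax)).
  by apply: fi; rewrite ?inE; [exact: (pE _).1 | exact: ax | exact: (pE _).2].
have /choice[gam gamP] : forall z : 'I_r * nat, exists g, link G a z.1 0 z.2 g.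
  by move=> z; exact: link_ex aG cG normG _ _ _.
have gamP' i k : link G a i 0 k (gam (i, k)) := gamP (i, k).
have [e' eK eK'] := chart_bij aG gamP' pnt_inj pntP.
exists s, r, (fun i => fiber a (i, 0) : Type), (fun i => localGroup G (fiber a (i, 0))).
exists (charted G eK eK'); split.
- move=> i; split; first exact: aH.
  by have [x xi] := ad_surj aG (i, 0); constructor; exact: (insub_set (xi : fiber a (i, 0) x)).
- exact: transport_iso.
- exact: (charted_block aG cG normG gamP').
- exact: (charted_fin_index aG cG normG gamP' pntP).
- exact: (charted_tight aG gamP' pntP).
Qed.

(** * Closure of the class under the four operations *)

Lemma fin_index_transport X Y (e : X -> Y) (e' : Y -> X) (P : permGroup Y)
    (Q R : set (X -> X)) (S : set (Y -> Y)) : cancel e e' -> cancel e' e ->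
  fin_index Q R -> (forall f, perms P f -> Q (e' \o f \o e)) ->
  (forall f, R (e' \o f \o e) -> S f) -> fin_index (perms P) S.
Proof.
move=> eK eK' [C [col colP]] PQ RS.
exists C, (fun f => col (e' \o f \o e)) => p q Pp Pq /(colP _ _ (PQ p Pp) (PQ q Pq)) Rpq.
apply: RS; move: Rpq; rewrite (@invf_eq _ _ (e' \o invf p \o e)).
- by congr R; apply/funext => x /=; rewrite eK'.
- by move=> x /=; rewrite eK' (permK Pp) eK.
- by move=> x /=; rewrite eK' (permKd Pp) eK.
Qed.

Lemma inhabited_family (I : Type) (T : I -> Type) :
  (forall i, inhabited (T i)) -> forall i, T i.
Proof.
move=> iT i; have [x _] : {x : T i & True}; last exact: x.
by apply: cid; have [x] := iT i; exists x.
Qed.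

(** The two statements are proved together: [structure_theorem] at level n+1 needs
    the finiteness of normalisers at level n, and [supergroup_HpredS] needs the
    closure under supergroups at level n. *)
Lemma H_supergroup_normaliser n :
  (forall X (H H' : permGroup X), perms H `<=` perms H' ->
     fin_index (perms H') (perms H) -> Hpred n H -> Hpred n H') /\
  (forall X (H : permGroup X), Hpred n H ->
     fin_index (perms (normaliser H)) (perms H)).
Proof.
elim: n => [|n [IHsup IHnorm]]; first by [].
split=> [X H H' HH' Hfin|X H] /(structure_theorem IHnorm);
  move=> [s [r [T [M [G' [HM /[dup] iso /isomorphicP[e [e' [eK eK' GH]]] WG' Wfin tG']]]]]];
  have x0 := inhabited_family (fun i => (HM i).2).
  pose K := transport eK eK' H'.
  have G'K : perms G' `<=` perms K by move=> f /GH; exact: HH'.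
  have KG' : fin_index (perms K) (perms G').
    by apply: (fin_index_transport eK eK' Hfin) => // f /GH.
  have KW : fin_index (perms K) (perms (blockGroup s M)).
    apply: (fin_index_trans KG'); have [C [col colP]] := Wfin.
    by exists C, col => p q [_ G'p] [_ G'q]; exact: colP.
  have HK : Hpred n.+1 K.
    apply: (supergroup_HpredS x0 _ KW IHsup); last by move=> i; exact: (HM i).1.
    exact: subset_trans G'K.
  apply: Hpred_iso HK; apply: isomorphic_sym; exact: transport_iso.
have nG' := normaliser_fin_index x0 WG' Wfin tG' (fun i => IHnorm _ _ (HM i).1).
apply: (fin_index_transport eK' eK nG') => f; last first.
  by move=> /GH; congr (perms H); apply/funext => x /=; rewrite !eK.
move=> [fb fH].
have invE : invf (e \o f \o e') = e \o invf f \o e'.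
  apply: invf_eq => x /=; first by rewrite eK invfK.
  by rewrite eK invfKd.
split; first by apply: bij_comp; [apply: bij_comp fb; exists e'|exists e].
move=> h /GH Hh; have [H1 H2] := fH _ Hh; rewrite invE; split; apply/GH.
  by move: H1; congr (perms H); apply/funext => x /=; rewrite !eK.
by move: H2; congr (perms H); apply/funext => x /=; rewrite !eK.
Qed.

Lemma Hpred_supergroup n X (H H' : permGroup X) :
  finite_index_supergroup H H' -> Hpred n H -> Hpred n H'.
Proof. by move=> /fin_indexP[HH' fi]; exact: (H_supergroup_normaliser n).1. Qed.

(** A block group with a single factor, unless the domain is empty. *)
Lemma Hpred_wreath n X (G : permGroup X) : Hpred n.+1 G -> Hpred n.+2 (wreath G).
Proof.
move=> HG; have [[x _]|nX] := pselect (exists x : X, True); last first.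
  apply: (@Hpred_leq 1) => //; apply: Hpred_finite.
  apply: (sub_finite_set _ (finite_set0 _)) => -[x ?] _.
  by apply: nX; exists x.
pose M (i : 'I_1) := G; pose D := blockDom 0 (fun _ : 'I_1 => X).
pose e (p : X * nat) : D := @pt 0 1 (fun=> X) ord0 p.1 p.2.
pose e' (p : D) : X * nat := match p with inl _ => (x, 0) | inr (existT _ xk) => xk end.
have eK : cancel e e' by move=> [].
have eK' : cancel e' e by case=> [[m m0]|[i [y k]]]; rewrite /e /pt /= ?(ord1 i)//; move: (m0).
have HW : Hpred n.+2 (blockGroup 0 M).
  apply: (@supergroup_HpredS _ _ _ M) => //.
  - by exists unit, (fun=> tt) => p q Wp Wq _; apply: perms_comp => //; exact: perms_invf.
  - by move=> Y H H'; exact: (H_supergroup_normaliser n.+1).1.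
apply: (Hpred_iso _ HW); apply: isomorphic_sym; apply/isomorphicP.
exists e, e'; split=> // f; split.
  move=> [al [be [beb aM ->]]]; exists (al ord0), (be ord0).
  by split; [exact: beb | exact: (aM ord0) |].
move=> [al [be [beb aM fE]]]; exists (fun _ => al), (fun _ => be); split=> //.
apply/funext => p; rewrite -[LHS]eK' -[in LHS](eK' p).
by case: p => [[m m0]|[i [y k]]]; [move: (m0)|have := fE y k; rewrite /= /e /pt/= (ord1 i) => ->].
Qed.

Section product.
Variables (k : nat) (X : 'I_k -> Type) (G : forall l, permGroup (X l)).

(** The elements of a direct product, given by their restrictions to the factors. *)
Definition diag (h : forall l, X l -> X l) (p : {l : 'I_k & X l}) : {l : 'I_k & X l} :=
  existT X (tag p) (h (tag p) (tagged p)).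

Lemma diag_product h : (forall l, perms (G l) (h l)) -> perms (directProduct G) (diag h).
Proof.
move=> hG; split; last by move=> l; exists (h l).
exists (diag (fun l => invf (h l))) => -[l x]; rewrite /diag /=.
  by rewrite (permK (hG l)).
by rewrite (permKd (hG l)).
Qed.

Lemma directProduct_diag f : perms (directProduct G) f ->
  exists2 h, forall l, perms (G l) (h l) & f = diag h.
Proof.
move=> [_ fG]; exists (fun l => s2val (cid2 (fG l))).
  by move=> l; case: cid2.
by apply/funext => -[l x]; rewrite /diag /=; case: cid2.
Qed.

Lemma pclosed_directProduct : (forall l, pclosed (G l)) -> pclosed (directProduct G).
Proof.
move=> cG f fb fA; split=> // l.
have ftag p : tag (f p) = tag p.
  have [g /directProduct_diag[h _ ->] ->] := fA [set p] (finite_set1 p); last by [].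
  by [].
have /choice[g gE] : forall x, exists y, f (existT X l x) = existT X l y.
  move=> x; have := ftag (existT X l x); case: (f _) => j y /= jl.
  by case: _ / (esym jl) y => y; exists y.
have [f' fK fK'] := fb.
exists g => //; apply: cG.
  apply: inj_surj_bij => [x y xy|y].
    have : f (existT X l x) = f (existT X l y) by rewrite !gE xy.
    by move=> /(can_inj fK) /existT_inj.
  case E : (f' (existT X l y)) => [j x].
  have jl : j = l by have := ftag (f' (existT X l y)); rewrite fK' E.
  move: x E; rewrite jl => x E; exists x; apply: existT_inj.
  by rewrite -gE -E fK'.
move=> A finA.
have [h /directProduct_diag[d dG ->] fh] := fA _ (finite_image (existT X l) finA).
exists (d l) => // x Ax; apply: existT_inj.
by rewrite -gE fh//; exists x.
Qed.

(** The Nabla-classes of the product are those of all factors, so they are indexed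
    by a sigma type. *)
Lemma Hpred_directProduct n : (forall l, Hpred n.+1 (G l)) -> Hpred n.+1 (directProduct G).
Proof.
move=> HG.
have cG l : pclosed (G l) := Hpred_pclosed (HG l).
have aP l : {r & {a : X l -> option ('I_r * nat) | addressing (G l) a /\
    forall z, Hpred n (localGroup (G l) (fiber a z))}}.
  have /cid[r /cid aP] := (HpredS_elim (HG l)).2.
  by exists r.
pose r l := projT1 (aP l); pose a l : X l -> option ('I_(r l) * nat) := sval (projT2 (aP l)).
have aG l : addressing (G l) (a l) by have [] := svalP (projT2 (aP l)).
have aH l z : Hpred n (localGroup (G l) (fiber (a l) z)).
  by have [_] := svalP (projT2 (aP l)).
pose I : finType := {l : 'I_k & 'I_(r l)}.
pose emb l (z : 'I_(r l) * nat) : I * nat := (Tagged (fun l => 'I_(r l)) z.1, z.2).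
have emb_inj l : injective (emb l).
  by move=> [i m] [j m'] [/existT_inj -> ->].
pose b (p : {l : 'I_k & X l}) : option (I * nat) := omap (emb (tag p)) (a (tag p) (tagged p)).
have bP p i m : b p = Some (i, m) -> exists x j, [/\ p = existT X (tag i) x,
    i = existT (fun l => 'I_(r l)) (tag i) j & a (tag i) x = Some (j, m)].
  case: p => l x; rewrite /b /=; case E : (a l x) => [[j m']|//] /= [<- <-].
  by exists x, j.
have bE l x j m : b (existT X l x) = Some (existT _ l j, m) <-> a l x = Some (j, m).
  rewrite /b /=; split=> [|->//]; case: (a l x) => [[j' m']|//] /= [].
  by move=> /existT_inj -> ->.
have b_eq f p q : perms (directProduct G) f -> b p = b q -> b (f p) = b (f q).
  move=> /directProduct_diag[h hG ->].
  case E : (b q) => [[i m]|] bp.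
    have [x [j [-> iE xj]]] := bP _ _ _ bp; have [y [j' [-> iE' yj']]] := bP _ _ _ E.
    have jj' : j = j' by apply: (@existT_inj _ (fun l => 'I_(r l)) (tag i) j j'); rewrite -iE.
    rewrite /b /diag /=; congr omap; apply: (ad_eq (aG _)) => //.
    by rewrite xj yj' jj'.
  have bN p' : b p' = None -> b (diag h p') = None.
    case: p' => l x; rewrite /b /=; case E' : (a l x) => [//|] _.
    by rewrite (ad_none (aG l) (hG l) E').
  by rewrite !bN.
apply: (HpredS_intro (pclosed_directProduct cG) (a := b)); first split.
- have -> : [set x | b x = None] = \bigcup_(l in [set: 'I_k])
      (existT X l @` [set x | a l x = None]).
    apply/predeqP => -[l x]; split=> [bx|[j _ [y /= yN] <-]].
      exists l => //; exists x => //=; move: bx; rewrite /b /=.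
      by case: (a l x).
    by rewrite /b /= yN.
  apply: bigcup_finite => [|l _]; first exact: finite_finset.
  exact: finite_image (ad_fin (aG l)).
- move=> [[l j] m]; have [x xj] := ad_surj (aG l) (j, m).
  by exists (existT X l x); apply/bE.
- move=> f p /directProduct_diag[h hG ->]; case: p => l x; rewrite /b /=.
  case E' : (a l x) => [//|] _.
  by rewrite (ad_none (aG l) (hG l) E').
- exact: b_eq.
- move=> f p q Gf; case E : (b q) => [[i m]|].
    case E' : (b p) => [[i' m']|//] /= [ii]; rewrite ii in E'.
    have [x [j [-> iE xj]]] := bP _ _ _ E'; have [y [j' [-> iE' yj']]] := bP _ _ _ E.
    have jj' : j = j' by apply: (@existT_inj _ (fun l => 'I_(r l)) (tag i) j j'); rewrite -iE.
    have [h hG ->] := directProduct_diag Gf; rewrite /b /diag /=.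
    have : omap fst (a (tag i) x) = omap fst (a (tag i) y) by rewrite xj yj' jj'.
    move=> /(ad_idx (aG _) (hG (tag i))).
    by case: (a _ _) => [[c d]|]; case: (a _ _) => [[c' d']|] //= [->].
  case E' : (b p) => [//|] _; congr omap; apply: b_eq => //.
  by rewrite E.
- move=> [l j] be beb; have [g [Gg gb gi]] := ad_sym (aG l) j beb.
  exists (diag (dfwith (fun l x => x) l g)); split.
  + by apply: diag_product => l'; case: dfwithP => // l'' _; exact: perms_id.
  + move=> p m /bP[x [j' [-> /= /existT_inj <- xj]]].
    by rewrite /diag /= dfwithin; apply/bE; exact: gb.
  + case=> l' x; rewrite /diag /b /=; have [ll|ll] := eqVneq l l'; last by rewrite dfwithout.
    case: l' / ll x => x xj; rewrite dfwithin gi// => xj'; apply: xj.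
    by move: xj'; case: (a l x) => [[c d]|//] /= [->].
move=> [[l j] m]; apply: Hpred_iso (aH l (j, m)).
apply: (@localGroup_iso _ _ _ _ _ (fun x => existT X l (val x))).
- by move=> x y /existT_inj/val_inj.
- move=> p; split=> [/bP[x [j' [-> /= /existT_inj <- xj]]]|[x <-]].
    by exists (insub_set (xj : fiber (a l) (j, m) x)).
  by apply/bE; exact: (set_valP x).
- move=> n0 [_ [g [Gg gz] gE]]; exists (diag (dfwith (fun l x => x) l g)); split.
  + by apply: diag_product => l'; case: dfwithP => // l'' _; exact: perms_id.
  + case=> l' x; rewrite /diag /=; have [ll|ll] := eqVneq l l'; last by rewrite dfwithout.
    case: l' / ll x => x xj; rewrite dfwithin.
    by rewrite gz// => xj'; apply: xj; apply/bE.
  + by move=> x; rewrite /diag /= dfwithin gE.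
- move=> g /directProduct_diag[h hG ->] hid.
  have hz x : ~ fiber (a l) (j, m) x -> h l x = x.
    move=> xz; apply: existT_inj; apply: hid (existT X l x) _ => xz'; apply: xz.
    exact/bE.
  have [n0 Gn nE] := localGroup_ex (hG l) hz; exists n0 => // x.
  by rewrite /diag /= nE.
Qed.

End product.

(** * Derivations *)

(** The condition on the members of the sequence, with the earlier members replaced
    by a predicate [A], so that sequences can be concatenated without renumbering. *)
Definition step (A : dPermGroup -> Prop) (G : dPermGroup) : Prop :=
  [\/ exists2 H, A H & isomorphic G H,
      exists (k : nat) (F : 'I_k -> dPermGroup), (forall l, A (F l)) /\
        G = DPermGroup (directProduct (fun l => grp (F l))),
      exists2 H, A H & G = DPermGroup (wreath (grp H))
    | exists2 H, A H & exists (X : Type) (K K' : permGroup X),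
        [/\ H = DPermGroup K, G = DPermGroup K' & finite_index_supergroup K K']].

Definition before (Gs : nat -> dPermGroup) (i : nat) (H : dPermGroup) : Prop :=
  exists2 j, j < i & Gs j = H.

Definition chain (m : nat) (Gs : nat -> dPermGroup) : Prop :=
  Gs 0 = DPermGroup (trivialGroup unit) /\
  forall i, 0 < i <= m -> step (before Gs i) (Gs i).

Definition derivable (G : dPermGroup) : Prop :=
  exists m Gs, chain m Gs /\ before Gs m.+1 G.

Lemma stepW (A B : dPermGroup -> Prop) G : (forall H, A H -> B H) -> step A G -> step B G.
Proof.
move=> AB [[H AH GH]|[k [F [AF GF]]]|[H AH GH]|[H AH GH]].
- by constructor 1; exists H => //; exact: AB.
- by constructor 2; exists k, F; split=> // l; exact: AB.
- by constructor 3; exists H => //; exact: AB.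
- by constructor 4; exists H => //; exact: AB.
Qed.

Lemma isomorphic_refl G : isomorphic G G.
Proof.
case: G => X G; apply/isomorphicP; exists id, id; split=> // f.
Qed.

Lemma derivable_trivial : derivable (DPermGroup (trivialGroup unit)).
Proof.
exists 0, (fun=> DPermGroup (trivialGroup unit)); split; last by exists 0.
by split=> // i; rewrite leqn0 => /andP[i0 /eqP iE]; rewrite iE in i0.
Qed.

(** The second sequence is appended to the first; its initial trivial group is an
    isomorphic copy of the first one. *)
Lemma chain_cat m1 Gs1 m2 Gs2 : chain m1 Gs1 -> chain m2 Gs2 ->
  exists m Gs, [/\ chain m Gs, forall H, before Gs1 m1.+1 H -> before Gs m.+1 H &
    forall H, before Gs2 m2.+1 H -> before Gs m.+1 H].
Proof.
move=> [G10 G1] [G20 G2].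
pose Gs i := if i <= m1 then Gs1 i else Gs2 (i - m1.+1).
have Gs1E i : i <= m1 -> Gs i = Gs1 i by rewrite /Gs => ->.
have Gs2E i : Gs (i + m1.+1) = Gs2 i.
  by rewrite /Gs addnS ltnNge leq_addl /= -addnS addnK.
have b2 i H : before Gs2 i H -> before Gs (i + m1.+1) H.
  by move=> [j ji <-]; exists (j + m1.+1); rewrite ?ltn_add2r.
exists (m2 + m1.+1), Gs; split.
- split; first by rewrite Gs1E.
  move=> i /andP[i0 im]; have [im1|im1] := leqP i m1.
    rewrite Gs1E//; apply: stepW (G1 i _); last by rewrite i0.
    by move=> _ [j ji <-]; exists j => //; rewrite Gs1E// (leq_trans (ltnW ji)).
  rewrite -(subnK im1) Gs2E; set n := i - m1.+1.
  have nm : n <= m2 by rewrite leq_subLR addnC.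
  have [n0|n0] := posnP n; last first.
    by apply: stepW (G2 n _); [exact: b2 | rewrite n0].
  rewrite n0 G20; constructor 1; exists (DPermGroup (trivialGroup unit)).
    by exists 0 => //; rewrite Gs1E.
  exact: isomorphic_refl.
- move=> _ [j jm <-]; exists j; last by rewrite Gs1E.
  by rewrite (leq_trans jm)// ltnS addnS ltnW// ltnS leq_addl.
- by rewrite -addSn; exact: b2.
Qed.

Lemma derivable_family k (F : nat -> dPermGroup) : (forall l, l < k -> derivable (F l)) ->
  exists m Gs, chain m Gs /\ forall l, l < k -> before Gs m.+1 (F l).
Proof.
elim: k => [_|k IHk dF].
  by have [m [Gs [cGs _]]] := derivable_trivial; exists m, Gs.
have [l lk|m1 [Gs1 [c1 F1]]] := IHk; first by apply: dF; exact: ltnW.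
have [m2 [Gs2 [c2 F2]]] := dF k (ltnSn k).
have [m [Gs [c b1 b2]]] := chain_cat c1 c2.
exists m, Gs; split=> // l; rewrite ltnS leq_eqVlt => /predU1P[->|/F1/b1//].
exact: b2.
Qed.

Lemma derivable_before m Gs G : chain m Gs -> step (before Gs m.+1) G -> derivable G.
Proof.
move=> [G0 cGs] st; pose Gs' i := if i <= m then Gs i else G.
have E i : i <= m -> Gs' i = Gs i by rewrite /Gs' => ->.
have EG : Gs' m.+1 = G by rewrite /Gs' ltnn.
have bE i : i <= m.+1 -> forall H, before Gs i H -> before Gs' i H.
  by move=> im _ [j ji <-]; exists j => //; rewrite E// -ltnS (leq_trans ji).
exists m.+1, Gs'; split; last by exists m.+1.
split; first by rewrite E.
move=> i /andP[i0]; rewrite leq_eqVlt => /predU1P[->|im].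
  by rewrite EG; apply: stepW st; exact: bE.
by rewrite E//; apply: stepW (cGs i _); [apply: bE; exact: ltnW | rewrite i0].
Qed.

Lemma derivable_iso G H : derivable H -> isomorphic G H -> derivable G.
Proof.
move=> [m [Gs [cGs bH]]] GH; apply: (derivable_before cGs).
by constructor 1; exists H.
Qed.

Lemma derivable_directProduct k (F : 'I_k -> dPermGroup) : (forall l, derivable (F l)) ->
  derivable (DPermGroup (directProduct (fun l => grp (F l)))).
Proof.
move=> dF.
pose F' l := if insub l is Some l' then F l' else DPermGroup (trivialGroup unit).
have F'E (l : 'I_k) : F' l = F l by rewrite /F' valK.
have [l lk|m [Gs [cGs bF]]] := @derivable_family k F'.
  by rewrite (F'E (Ordinal lk)).
apply: (derivable_before cGs); constructor 2; exists k, F; split=> // l.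
by rewrite -F'E; exact: bF.
Qed.

Lemma derivable_wreath X (G : permGroup X) :
  derivable (DPermGroup G) -> derivable (DPermGroup (wreath G)).
Proof.
move=> [m [Gs [cGs bG]]]; apply: (derivable_before cGs).
by constructor 3; exists (DPermGroup G).
Qed.

Lemma derivable_supergroup X (G G' : permGroup X) : finite_index_supergroup G G' ->
  derivable (DPermGroup G) -> derivable (DPermGroup G').
Proof.
move=> GG' [m [Gs [cGs bG]]]; apply: (derivable_before cGs).
by constructor 4; exists (DPermGroup G) => //; exists X, G, G'.
Qed.

(** A block group is the product of two products, one of trivial groups and one
    of wreath products. *)
Lemma derivable_blockGroup s r (T : 'I_r -> Type) (M : forall i, permGroup (T i)) :
  (forall i, derivable (DPermGroup (M i))) -> derivable (DPermGroup (blockGroup s M)).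
Proof.
move=> dM.
pose A := DPermGroup (directProduct (fun _ : 'I_s => trivialGroup unit)).
pose B := DPermGroup (directProduct (fun i => wreath (M i))).
have dA : derivable A.
  exact: (@derivable_directProduct s (fun=> DPermGroup (trivialGroup unit))
    (fun=> derivable_trivial)).
have dB : derivable B.
  apply: (@derivable_directProduct r (fun i => DPermGroup (wreath (M i)))) => i.
  exact: derivable_wreath.
pose F (l : 'I_2) := if val l == 0 then A else B.
have dF : derivable (DPermGroup (directProduct (fun l => grp (F l)))).
  by apply: derivable_directProduct => l; rewrite /F; case: ifP.
apply: derivable_iso dF _; apply/isomorphic_sym/isomorphicP.
pose o0 : 'I_2 := @Ordinal 2 0 isT; pose o1 : 'I_2 := @Ordinal 2 1 isT.
pose P := {l : 'I_2 & Dom (F l)}.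
pose inA (x : Dom A) : P := existT (fun l => Dom (F l)) o0 x.
pose inB (x : Dom B) : P := existT (fun l => Dom (F l)) o1 x.
have PP (p : P) : (exists x, p = inA x) \/ exists x, p = inB x.
  case: p => l; have [->|->] : l = o0 \/ l = o1.
    by case: l => [[|[|//]] ?]; [left|right]; exact: val_inj.
  - by move=> x; left; exists x.
  - by move=> x; right; exists x.
pose e' (q : blockDom s T) : P :=
  match q with inl t => inA (existT _ t tt) | inr u => inB u end.
have [e e'K eK'] : bijective e'.
  apply: inj_surj_bij => [[t|u] [t'|u']|p] //=.
  - by move=> /existT_inj -[->].
  - by move=> /existT_inj ->.
  - by case: (PP p) => [[[t []] ->]|[u ->]]; [exists (inl t)|exists (inr u)].
have l01 (l : 'I_2) : l = o0 \/ l = o1.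
  by case: l => [[|[|//]] ?]; [left|right]; exact: val_inj.
exists e, e'; split=> // f; split.
  move=> [al [be [beb aM fE]]].
  have fb : bijective f.
    by apply: (@perms_bij _ (blockGroup s M)); exists al, be.
  split; first by apply: bij_comp; [apply: bij_comp fb; exists e|exists e'].
  move=> l; have [->|->] := l01 l.
    exists id; first exact: (perms_id A).
    move=> [t []]; rewrite /= -/(inA _).
    by rewrite -[inA _]/(e' (inl t)) e'K fE.
  exists (diag (fun i (xk : T i * nat) => (al i xk.2 xk.1, be i xk.2))).
    by apply: diag_product => i; exists (al i), (be i); split.
  move=> u; rewrite /= -[existT _ o1 u]/(e' (inr u)) e'K fE.
  by case: u => i [x k].
move=> [_ fF].
have [g0 /directProduct_diag[h0 h0E ->] fA] := fF o0.
have [g1 /directProduct_diag[h1 h1W ->] fB] := fF o1.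
have wP i : {al : nat -> T i -> T i & {be : nat -> nat | [/\ bijective be,
    forall k, perms (M i) (al k) & forall x k, h1 i (x, k) = (al k x, be k)]}}.
  by have /cid[al /cid[be wP]] := h1W i; exists al, be.
exists (fun i => projT1 (wP i)), (fun i => sval (projT2 (wP i))); split.
- by move=> i; have [] := svalP (projT2 (wP i)).
- by move=> i k; have [] := svalP (projT2 (wP i)).
apply/funext => -[t|[i [x k]]]; apply: (can_inj e'K).
  have := fA (existT _ t tt); rewrite /= -[existT _ o0 _]/(e' (inl t)) e'K => ->.
  by rewrite /diag /= h0E.
have := fB (existT _ i (x, k)).
rewrite /= -[existT _ o1 _]/(e' (inr (existT _ i (x, k)))) e'K => ->.
by rewrite /diag /=; have [_ _ ->] := svalP (projT2 (wP i)).
Qed.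

Lemma derivable_Hpred n X (G : permGroup X) : Hpred n G -> derivable (DPermGroup G).
Proof.
elim: n X G => // n IHn X G /structure_theorem.
move=> /(_ (H_supergroup_normaliser n).2)[s [r [T [M [G' [HM GG' WG' Wfin _]]]]]].
apply: derivable_iso GG'; apply: (@derivable_supergroup _ (blockGroup s M)).
  exact/fin_indexP.
by apply: derivable_blockGroup => i; apply: IHn; exact: (HM i).1.
Qed.

Lemma inH_step (A : dPermGroup -> Prop) G : (forall H, A H -> inH H) -> step A G -> inH G.
Proof.
move=> AH [[H /AH HH GH]|[k [F [AF ->]]]|[H /AH [n HH] ->]|[H /AH HH]].
- case: G GH => X G GH; case: H HH GH => Y H [n HH] GH; exists n.
  exact: Hpred_iso (isomorphic_sym GH) HH.
- have /choice[n nP] : forall l, exists n, Hpred n.+1 (grp (F l)).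
    by move=> l; exact: AH (AF l).
  exists (\max_l n l); apply: Hpred_directProduct => l.
  by apply: Hpred_leq (nP l); rewrite ltnS; exact: leq_bigmax.
- by exists n.+1; exact: Hpred_wreath.
- move=> [X [K [K' [HK -> KK']]]]; move: HH; rewrite HK => -[n HH].
  by exists n; exact: Hpred_supergroup KK' HH.
Qed.

Theorem corollary3p43 (G : dPermGroup) :
  inH G <->
  exists (m : nat) (Gs : nat -> dPermGroup),
    [/\ Gs m = G,
        Gs 0 = DPermGroup (trivialGroup unit) &
        forall i, 1 <= i <= m ->
        [\/ exists2 j, j < i & isomorphic (Gs i) (Gs j),
            exists (k : nat) (J : 'I_k -> nat),
              (forall l, J l < i) /\
              Gs i = DPermGroup (directProduct (fun l => grp (Gs (J l)))),
            exists2 j, j < i & Gs i = DPermGroup (wreath (grp (Gs j)))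
          | exists2 j, j < i &
              exists (X : Type) (H H' : permGroup X),
                [/\ Gs j = DPermGroup H, Gs i = DPermGroup H' &
                    finite_index_supergroup H H']]].
Proof.
split=> [[n]|[m [Gs [Gm G0 Gst]]]].
  case: G => X G /derivable_Hpred[m [Gs [[G0 cGs] [j jm Gj]]]].
  exists j, Gs; split=> // i /andP[i0 ij].
  have /cGs : 0 < i <= m by rewrite i0 (leq_trans ij).
  move=> [[H [l li <-] iso]|[k [F [AF iE]]]|[H [l li <-] iE]|[H [l li <-] iE]].
  - by constructor 1; exists l.
  - constructor 2; have /choice[J JP] : forall l, exists j', j' < i /\ Gs j' = F l.
      by move=> l; have [j' j'i j'E] := AF l; exists j'.
    exists k, J; split=> [l|]; first exact: (JP l).1.
    rewrite iE; have -> : F = fun l => Gs (J l) by apply/funext => l; rewrite (JP l).2.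
    by [].
  - by constructor 3; exists l.
  - by constructor 4; exists l.
suff HGs i : i <= m -> inH (Gs i) by rewrite -Gm; exact: HGs.
elim/ltn_ind: i => -[_ _|i IHi im].
  rewrite G0; exists 0; apply: Hpred_finite; exact: finite_finset.
apply: (@inH_step (before Gs i.+1)) => [_ [j ji <-]|].
  by apply: IHi => //; rewrite (leq_trans (ltnW ji)).
case: (Gst i.+1 im) => [[j ji iso]|[k [J [Ji ->]]]|[j ji ->]|[j ji KK]].
- by constructor 1; exists (Gs j) => //; exists j.
- by constructor 2; exists k, (fun l => Gs (J l)); split=> // l; exists (J l).
- by constructor 3; exists (Gs j) => //; exists j.
- by constructor 4; exists (Gs j) => //; exists j.
Qed.
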